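(* Let $q\in\mathbb{C}$ be nonzero and generic. The quotient $M_0(\mathbb{C}_q^2,\Delta_+)$ of the restricted comeasuring bialgebra $M_0(\mathbb{C}_q^2)$ respecting the braided coaddition $\Delta_+$ on the quantum-braided plane $\mathbb{C}_q^2$ can be identified, as a bialgebra, with the standard $2\times2$ quantum matrices $M_q(2)$ (with the generators $a,b,c,d$ of $M_q(2)$ corresponding to $t^{(1,0)}{}_{(1,0)},\ t^{(1,0)}{}_{(0,1)},\ t^{(0,1)}{}_{(1,0)},\ t^{(0,1)}{}_{(0,1)}$ respectively).
   Context: $\mathbb{Z}_+=\{0,1,2,\dots\}$. The quantum-braided plane $\mathbb{C}_q^2$ is the unital algebra over $\mathbb{C}$ generated by $x,y$ with $yx=qxy$, with basis $e_{(m,n)}=x^my^n$. Let $[n]_{q^2}=1+q^2+\cdots+q^{2(n-1)}$, $[n]_{q^2}!=[n]_{q^2}\cdots[1]_{q^2}$, with $\left[{m\atop r}\right]_{q^2}$ the corresponding binomial coefficients. ''Generic'' means that $[n]_{q^2}\ne0$ for all $n\ge1$. The braided coaddition is the coassociative linear map $$\Delta_+(x^my^n)=\sum_{r=0}^m\sum_{s=0}^n\left[{m\atop r}\right]_{q^2}\left[{n\atop s}\right]_{q^2}q^{(m-r)s}\,x^ry^s\otimes x^{m-r}y^{n-s}.$$ The restricted comeasuring bialgebra $M_0(\mathbb{C}_q^2)$ is the unital algebra generated by $t^I{}_J$, $I,J\in\mathbb{Z}_+\times\mathbb{Z}_+$, with relations $$\sum_{(a,b)+(c,d)=(m,n)}q^{bc}\,t^{(a,b)}{}_{(i,j)}t^{(c,d)}{}_{(k,l)}=q^{jk}t^{(m,n)}{}_{(i+k,j+l)}$$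 together with $t^{(0,0)}{}_{(0,0)}=1$ and $t^{(0,0)}{}_{I}=0=t^{I}{}_{(0,0)}$ for $I\ne(0,0)$, and with $\Delta t^I{}_J=\sum_Kt^I{}_K\otimes t^K{}_J$ and $\epsilon(t^I{}_J)=\delta^I{}_J$ (the sum is finite since in $M_0(\mathbb{C}_q^2)$ one has $t^{(i,j)}{}_{(k,l)}=0$ unless $i+j\ge k+l$). It coacts by $e_J\mapsto\sum_Ie_I\otimes t^I{}_J$. If $A$ has basis $\{e_i\}$ and a coalgebra structure $\Delta e_i=\sum d_i{}^{jk}e_j\otimes e_k$, the quotient $M_0(A,\Delta)$ of $M_0(A)$ respecting $\Delta$ is the quotient bialgebra by the additional relations $\sum_a d_a{}^{jk}t^a{}_i=\sum_{a,b}d_i{}^{ab}t^j{}_at^k{}_b$. For $(\mathbb{C}_q^2,\Delta_+)$ these are $$\sum_{(a,b)+(c,d)=(m,n)}\left[{m\atop a}\right]_{q^2}\left[{n\atop b}\right]_{q^2}q^{bc}\,t^{(i,j)}{}_{(a,b)}t^{(k,l)}{}_{(c,d)}=\left[{i+k\atop i}\right]_{q^2}\left[{j+l\atop j}\right]_{q^2}q^{jk}\,t^{(i+k,j+l)}{}_{(m,n)} .$$ $M_q(2)$ is the unital algebra generated by $a,b,c,d$ with relations $$ba=qab,\quad ca=qac,\quad dc=qcd,\quad db=qbd,\quad bc=cb,\quad ad-da=(q^{-1}-q)bc,$$ with the matrix coproduct and counit for the matrix $\begin{pmatrix}a&b\\c&d\end{pmatrix}$. *)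

(* Defs.v *)
From HB Require Import structures.
From mathcomp Require Import all_boot all_order all_algebra.
From mathcomp Require Import generic_quotient finmap.
From mathcomp Require Import boolp classical_sets fsbigop reals complex.
From mathcomp.multinomials Require Import monalg.

Set Implicit Arguments.
Unset Strict Implicit.
Unset Printing Implicit Defensive.

Import GRing.Theory.

Local Open Scope ring_scope.
Local Open Scope quotient_scope.

(* MathComp's algType excludes the zero ring, whereas an algebra given by
   generators and relations, or a quotient by an ideal, may collapse; this is
   the same notion (unital associative algebra) without 1 != 0. *)
Record algebra (K : fieldType) := Algebra {
  alg_mod : lmodType K;
  alg_one : alg_mod;
  alg_mul : alg_mod -> alg_mod -> alg_mod;
  alg_mulA : associative alg_mul;
  alg_mul1l : left_id alg_one alg_mul;
  alg_mul1r : right_id alg_one alg_mul;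
  alg_mulDl : left_distributive alg_mul +%R;
  alg_mulDr : right_distributive alg_mul +%R;
  alg_scaleAl : forall k u v, k *: alg_mul u v = alg_mul (k *: u) v;
  alg_scaleAr : forall k u v, k *: alg_mul u v = alg_mul u (k *: v)
}.

Definition alg_car (K : fieldType) (A : algebra K) : Type := alg_mod A.
Coercion alg_car : algebra >-> Sortclass.

Section AlgebraTheory.
Context (K : fieldType) (A : algebra K).

HB.instance Definition _ := GRing.Lmodule.copy (alg_car A) (alg_mod A).
HB.instance Definition _ := GRing.Zmodule_isPzRing.Build (alg_car A)
  (@alg_mulA K A) (@alg_mul1l K A) (@alg_mul1r K A)
  (@alg_mulDl K A) (@alg_mulDr K A).

Lemma algZAl k (u v : A) : k *: (u * v) = (k *: u) * v.
Proof. exact: alg_scaleAl. Qed.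
Lemma algZAr k (u v : A) : k *: (u * v) = u * (k *: v).
Proof. exact: alg_scaleAr. Qed.

End AlgebraTheory.

Definition alg_morphism (K : fieldType) (A B : algebra K) (f : A -> B) : Prop :=
  linear f /\ monoid_morphism f.

(* Blocks the unfolding of operations on quotients during unification. *)
Fact quot_key : unit. Proof. exact: tt. Qed.

Section QuotientModule.
Context (K : fieldType) (V : lmodType K).

Record subspace := Subspace {
  subspace_pred :> V -> Prop;
  subspace0 : subspace_pred 0;
  subspaceD : forall u v,
    subspace_pred u -> subspace_pred v -> subspace_pred (u + v);
  subspaceZ : forall k u, subspace_pred u -> subspace_pred (k *: u)
}.

Section Span.
Variable S : V -> Prop.

Definition in_span (v : V) : Prop :=
  forall W : subspace, (forall u, S u -> W u) -> W v.

Fact in_span0 : in_span 0. Proof. by move=> W _; apply: subspace0. Qed.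
Fact in_spanD u v : in_span u -> in_span v -> in_span (u + v).
Proof. by move=> hu hv W hW; apply: subspaceD; [apply: hu | apply: hv]. Qed.
Fact in_spanZ k u : in_span u -> in_span (k *: u).
Proof. by move=> hu W hW; apply/subspaceZ/hu. Qed.

Definition span : subspace := Subspace in_span0 in_spanD in_spanZ.

End Span.

Variable W : subspace.

Lemma subspaceN u : W u -> W (- u).
Proof. by move=> hu; rewrite -scaleN1r; apply: subspaceZ. Qed.

Definition quotm_rel (u v : V) : bool := `[< W (u - v) >].

Fact quotm_rel_refl : reflexive quotm_rel.
Proof. by move=> u; apply/asboolP; rewrite subrr; apply: subspace0. Qed.
Fact quotm_rel_sym : symmetric quotm_rel.
Proof.
by move=> u v; apply/asboolP/asboolP => /subspaceN; rewrite opprB.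
Qed.
Fact quotm_rel_trans : transitive quotm_rel.
Proof.
move=> v u w /asboolP huv /asboolP hvw; apply/asboolP.
by have := subspaceD huv hvw; rewrite addrA subrK.
Qed.

Canonical quotm_equiv :=
  EquivRel quotm_rel quotm_rel_refl quotm_rel_sym quotm_rel_trans.

Definition quotm := {eq_quot quotm_equiv}.
HB.instance Definition _ := Choice.on quotm.
HB.instance Definition _ : EqQuotient V quotm_equiv quotm :=
  EqQuotient.on quotm.

Definition quotm_pi : V -> quotm :=
  locked_with quot_key (fun v => \pi_quotm v).
Canonical quotm_pi_unlockable := [unlockable fun quotm_pi].

Lemma quotm_piP u v : quotm_pi u = quotm_pi v <-> W (u - v).
Proof.
rewrite unlock; split; first by move/eqP; rewrite eqmodE => /asboolP.
by move=> h; apply/eqP; rewrite eqmodE; apply/asboolP.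
Qed.

Lemma quotm_reprK x : quotm_pi (repr x) = x. Proof. by rewrite unlock reprK. Qed.

Lemma quotm_repr v : W (repr (quotm_pi v) - v).
Proof. by apply/quotm_piP; rewrite quotm_reprK. Qed.

Definition quotm_add : quotm -> quotm -> quotm :=
  locked_with quot_key (fun x y => quotm_pi (repr x + repr y)).
Canonical quotm_add_unlockable := [unlockable fun quotm_add].
Definition quotm_opp : quotm -> quotm :=
  locked_with quot_key (fun x => quotm_pi (- repr x)).
Canonical quotm_opp_unlockable := [unlockable fun quotm_opp].
Definition quotm_scale : K -> quotm -> quotm :=
  locked_with quot_key (fun k x => quotm_pi (k *: repr x)).
Canonical quotm_scale_unlockable := [unlockable fun quotm_scale].

Lemma quotm_piD u v : quotm_add (quotm_pi u) (quotm_pi v) = quotm_pi (u + v).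
Proof.
rewrite [quotm_add]unlock; apply/quotm_piP; rewrite opprD addrACA.
by apply: subspaceD; apply: quotm_repr.
Qed.

Lemma quotm_piN u : quotm_opp (quotm_pi u) = quotm_pi (- u).
Proof.
rewrite [quotm_opp]unlock; apply/quotm_piP; rewrite -opprD.
exact/subspaceN/quotm_repr.
Qed.

Lemma quotm_piZ k u : quotm_scale k (quotm_pi u) = quotm_pi (k *: u).
Proof.
rewrite [quotm_scale]unlock; apply/quotm_piP; rewrite -scalerBr.
exact/subspaceZ/quotm_repr.
Qed.

Lemma quotm_ind (P : quotm -> Prop) : (forall v, P (quotm_pi v)) -> forall x, P x.
Proof. by move=> h x; rewrite -[x]quotm_reprK. Qed.

Fact quotm_addA : associative quotm_add.
Proof.
elim/quotm_ind=> u; elim/quotm_ind=> v; elim/quotm_ind=> w.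
by rewrite !quotm_piD addrA.
Qed.
Fact quotm_addC : commutative quotm_add.
Proof. by elim/quotm_ind=> u; elim/quotm_ind=> v; rewrite !quotm_piD addrC. Qed.
Fact quotm_add0 : left_id (quotm_pi 0) quotm_add.
Proof. by elim/quotm_ind=> u; rewrite quotm_piD add0r. Qed.
Fact quotm_addN : left_inverse (quotm_pi 0) quotm_opp quotm_add.
Proof. by elim/quotm_ind=> u; rewrite quotm_piN quotm_piD addNr. Qed.

HB.instance Definition _ :=
  GRing.isZmodule.Build quotm quotm_addA quotm_addC quotm_add0 quotm_addN.

Fact quotm_scaleA a b x :
  quotm_scale a (quotm_scale b x) = quotm_scale (a * b) x.
Proof. by elim/quotm_ind: x => u; rewrite !quotm_piZ scalerA. Qed.
Fact quotm_scale1 : left_id 1 quotm_scale.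
Proof. by elim/quotm_ind=> u; rewrite quotm_piZ scale1r. Qed.
Fact quotm_scaleDr : right_distributive quotm_scale +%R.
Proof.
move=> k; elim/quotm_ind=> u; elim/quotm_ind=> v.
by rewrite -[_ + _]/(quotm_add _ _) -[RHS]/(quotm_add _ _) !(quotm_piD, quotm_piZ) scalerDr.
Qed.
Fact quotm_scaleDl x : {morph quotm_scale^~ x : a b / a + b}.
Proof.
move=> a b; elim/quotm_ind: x => u.
by rewrite -[RHS]/(quotm_add _ _) !(quotm_piD, quotm_piZ) scalerDl.
Qed.

HB.instance Definition _ := GRing.Zmodule_isLmodule.Build K quotm
  quotm_scaleA quotm_scale1 quotm_scaleDr quotm_scaleDl.

Lemma quotm_pi_linear : linear quotm_pi.
Proof. by move=> k u v; rewrite -quotm_piD -quotm_piZ. Qed.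

HB.instance Definition _ :=
  GRing.isLinear.Build K V quotm *:%R quotm_pi quotm_pi_linear.

End QuotientModule.

Section QuotientAlgebra.
Context (K : fieldType) (A : algebra K).

Record ideal := Ideal {
  ideal_subspace :> subspace A;
  idealMl : forall a u, ideal_subspace u -> ideal_subspace (a * u);
  idealMr : forall a u, ideal_subspace u -> ideal_subspace (u * a)
}.

Section Generated.
Variable S : A -> Prop.

Definition in_genideal (u : A) : Prop :=
  forall J : ideal, (forall s, S s -> J s) -> J u.

Fact in_genideal0 : in_genideal 0.
Proof. by move=> J _; apply: subspace0. Qed.
Fact in_genidealD u v : in_genideal u -> in_genideal v -> in_genideal (u + v).
Proof. by move=> hu hv J hJ; apply: subspaceD; [apply: hu | apply: hv]. Qed.
Fact in_genidealZ k u : in_genideal u -> in_genideal (k *: u).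
Proof. by move=> hu J hJ; apply/subspaceZ/hu. Qed.
Fact in_genidealMl a u : in_genideal u -> in_genideal (a * u).
Proof. by move=> hu J hJ; apply/idealMl/hu. Qed.
Fact in_genidealMr a u : in_genideal u -> in_genideal (u * a).
Proof. by move=> hu J hJ; apply/idealMr/hu. Qed.

Definition genideal : ideal :=
  @Ideal (Subspace in_genideal0 in_genidealD in_genidealZ)
    in_genidealMl in_genidealMr.

End Generated.

Variable J : ideal.

Definition quota_mul : quotm J -> quotm J -> quotm J :=
  locked_with quot_key (fun x y => quotm_pi J (repr x * repr y)).
Canonical quota_mul_unlockable := [unlockable fun quota_mul].

Local Notation mul := quota_mul.

Let piM u v : mul (quotm_pi J u) (quotm_pi J v) = quotm_pi J (u * v).
Proof.
rewrite [mul]unlock; apply/quotm_piP; rewrite -[X in X - _](subrK (repr (quotm_pi J u) * v)).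
rewrite -mulrBr -addrA -mulrBl.
by apply: subspaceD; [apply: idealMl | apply: idealMr]; apply: quotm_repr.
Qed.

Fact quota_mulA : associative mul.
Proof.
elim/quotm_ind=> u; elim/quotm_ind=> v; elim/quotm_ind=> w.
by rewrite !piM mulrA.
Qed.
Fact quota_mul1l : left_id (quotm_pi J 1) mul.
Proof. by elim/quotm_ind=> u; rewrite piM mul1r. Qed.
Fact quota_mul1r : right_id (quotm_pi J 1) mul.
Proof. by elim/quotm_ind=> u; rewrite piM mulr1. Qed.
Fact quota_mulDl : left_distributive mul +%R.
Proof.
elim/quotm_ind=> u; elim/quotm_ind=> v; elim/quotm_ind=> w.
by rewrite -raddfD !piM -raddfD mulrDl.
Qed.
Fact quota_mulDr : right_distributive mul +%R.
Proof.
elim/quotm_ind=> u; elim/quotm_ind=> v; elim/quotm_ind=> w.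
by rewrite -raddfD !piM -raddfD mulrDr.
Qed.
Fact quota_scaleAl (k : K) x y : k *: mul x y = mul (k *: x) y.
Proof.
elim/quotm_ind: x => u; elim/quotm_ind: y => v.
by rewrite -[RHS]/(mul (quotm_scale _ _) _) -[LHS]/(quotm_scale _ _) !(piM, quotm_piZ) algZAl.
Qed.
Fact quota_scaleAr (k : K) x y : k *: mul x y = mul x (k *: y).
Proof.
elim/quotm_ind: x => u; elim/quotm_ind: y => v.
by rewrite -[RHS]/(mul _ (quotm_scale _ _)) -[LHS]/(quotm_scale _ _) !(piM, quotm_piZ) algZAr.
Qed.

Definition quota : algebra K := Algebra quota_mulA quota_mul1l quota_mul1r
  quota_mulDl quota_mulDr quota_scaleAl quota_scaleAr.

Definition quota_pi : A -> quota := quotm_pi J.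

Lemma quota_pi_morphism : alg_morphism quota_pi.
Proof. by split; [apply: quotm_pi_linear | split=> // u v; rewrite [RHS]piM]. Qed.

Lemma quota_piP u v : quota_pi u = quota_pi v <-> J (u - v).
Proof. exact: quotm_piP. Qed.

Lemma quota_ind (P : quota -> Prop) : (forall u, P (quota_pi u)) -> forall x, P x.
Proof. exact: quotm_ind. Qed.

End QuotientAlgebra.

Section FreeAlgebra.
Context (K : fieldType) (X : choiceType).

Fact freealg_scaleAr (k : K) (u v : {malg K[{fmonom X}]}) :
  k *: (u * v) = u * (k *: v).
Proof.
apply/malgP=> m; rewrite mcoeffZ mcoeffMl mulr_sumr.
rewrite (mcoeffMlw _ (fsubset_refl _) (msuppZ_le k v)).
apply: eq_bigr => i _; rewrite mulr_sumr; apply: eq_bigr => j _.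
by rewrite mcoeffZ mulrnAr mulrCA.
Qed.

Definition freealg : algebra K :=
  Algebra (alg_mod := {malg K[{fmonom X}]}) (@mulrA _) (@mul1r _) (@mulr1 _)
    (@mulrDl _) (@mulrDr _) (@scalerAl K _) freealg_scaleAr.

Definition freegen (x : X) : freealg := << fmu x >>.

End FreeAlgebra.

Section LinearExtension.
Context (K : fieldType) (I : choiceType) (V : lmodType K) (f : I -> V).

Definition malg_lift (g : {malg K[I]}) : V := \sum_(i <- msupp g) g@_i *: f i.

Lemma malg_liftEw (d : {fset I}) g :
  (msupp g `<=` d)%fset -> malg_lift g = \sum_(i <- d) g@_i *: f i.
Proof.
move=> le; apply: big_fset_incl => // i _ /mcoeff_outdom ->.
by rewrite scale0r.
Qed.

Lemma malg_lift_linear : linear malg_lift.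
Proof.
move=> k u v; pose d := (msupp u `|` msupp v)%fset.
have hu : (msupp u `<=` d)%fset by apply: fsubsetUl.
have hv : (msupp v `<=` d)%fset by apply: fsubsetUr.
have hw : (msupp (k *: u + v) `<=` d)%fset.
  apply: fsubset_trans (msuppD_le _ _) _.
  by apply: fsetSU; apply: msuppZ_le.
rewrite (malg_liftEw hu) (malg_liftEw hv) (malg_liftEw hw) scaler_sumr -big_split.
by apply: eq_bigr => i _; rewrite /= mcoeffD mcoeffZ scalerDl scalerA.
Qed.

HB.instance Definition _ :=
  GRing.isLinear.Build K {malg K[I]} V *:%R malg_lift malg_lift_linear.

Lemma malg_liftU i : malg_lift << i >> = f i.
Proof. by rewrite (malg_liftEw msuppU_le) big_seq_fset1 mcoeffUU scale1r. Qed.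

End LinearExtension.

Section TensorModule.
Context (K : fieldType) (A B : algebra K).

Local Notation pure a b := (<< (a, b) >> : {malg K[(A * B)%type]}).

Variant tens_rel : {malg K[(A * B)%type]} -> Prop :=
| TensDl a a' b : tens_rel (pure (a + a') b - (pure a b + pure a' b))
| TensDr a b b' : tens_rel (pure a (b + b') - (pure a b + pure a b'))
| TensZl k a b : tens_rel (pure (k *: a) b - k *: pure a b)
| TensZr k a b : tens_rel (pure a (k *: b) - k *: pure a b).

Definition tensm : lmodType K := quotm (span tens_rel).

Definition tensor (a : A) (b : B) : tensm := quotm_pi (span tens_rel) (pure a b).

Let tens_eq u v : tens_rel (u - v) ->
  quotm_pi (span tens_rel) u = quotm_pi (span tens_rel) v.
Proof. by move=> h; apply/quotm_piP => W; apply. Qed.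

Lemma tensorDl a a' b : tensor (a + a') b = tensor a b + tensor a' b.
Proof. by rewrite -raddfD; apply/tens_eq/TensDl. Qed.
Lemma tensorDr a b b' : tensor a (b + b') = tensor a b + tensor a b'.
Proof. by rewrite -raddfD; apply/tens_eq/TensDr. Qed.
Lemma tensorZl k a b : tensor (k *: a) b = k *: tensor a b.
Proof. by rewrite -[RHS]linearZ; apply/tens_eq/TensZl. Qed.
Lemma tensorZr k a b : tensor a (k *: b) = k *: tensor a b.
Proof. by rewrite -[RHS]linearZ; apply/tens_eq/TensZr. Qed.

Lemma tens_ind (P : tensm -> Prop) :
    (forall a b, P (tensor a b)) -> P 0 ->
    (forall u v, P u -> P v -> P (u + v)) ->
    (forall k u, P u -> P (k *: u)) ->
  forall t, P t.
Proof.
move=> hp h0 hD hZ; elim/quotm_ind=> g.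
rewrite [g]monalgE raddf_sum; elim/big_ind: _ => // -[a b] _.
have -> : << g@_(a, b) *g (a, b) >> = g@_(a, b) *: pure a b.
  by apply/malgP=> k; rewrite mcoeffZ !mcoeffU mulr_natr.
by rewrite /= linearZ; apply/hZ/hp.
Qed.

Section Lift.
Context (V : lmodType K) (f : A -> B -> V).

(* Independent of the representative only when f is bilinear (tens_liftE). *)
Definition tens_lift (t : tensm) : V :=
  malg_lift (fun p : A * B => f p.1 p.2) (repr (t : quotm (span tens_rel))).

Definition bilin : Prop := (forall b, linear (f^~ b)) /\ (forall a, linear (f a)).

Hypothesis fbil : bilin.

Local Notation L := (malg_lift (fun p : A * B => f p.1 p.2)).

Let tens_lift_pi g : tens_lift (quotm_pi (span tens_rel) g) = L g.
Proof.
have ker_add : forall u v, L u = 0 -> L v = 0 -> L (u + v) = 0.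
  by move=> u v; rewrite raddfD /= => -> ->; rewrite addr0.
have ker_scale : forall k u, L u = 0 -> L (k *: u) = 0.
  by move=> k u hu; rewrite linearZ /= hu scaler0.
pose ker := Subspace (linear0 L) ker_add ker_scale.
apply/eqP; rewrite -subr_eq0 -[X in _ - X]/(L g) -raddfB; apply/eqP.
have := @quotm_repr _ _ (span tens_rel) g; move/(_ ker); apply => _ [a a' b|a b b'|k a b|k a b] /=.
- rewrite raddfB raddfD /= !malg_liftU /=.
  by have := fbil.1 b 1 a a'; rewrite !scale1r => ->; rewrite subrr.
- rewrite raddfB raddfD /= !malg_liftU /=.
  by have := fbil.2 a 1 b b'; rewrite !scale1r => ->; rewrite subrr.
- rewrite raddfB /= linearZ /= !malg_liftU /=.
  have f0 : f 0 b = 0.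
    have := fbil.1 b 1 0 0; rewrite !scale1r addr0 => /eqP.
    by rewrite -subr_eq subrr => /eqP.
  by have := fbil.1 b k a 0; rewrite addr0 => ->; rewrite f0 addr0 subrr.
rewrite raddfB /= linearZ /= !malg_liftU /=.
have f0 : f a 0 = 0.
  have := fbil.2 a 1 0 0; rewrite !scale1r addr0 => /eqP.
  by rewrite -subr_eq subrr => /eqP.
by have := fbil.2 a k b 0; rewrite addr0 => ->; rewrite f0 addr0 subrr.
Qed.

Lemma tens_liftE a b : tens_lift (tensor a b) = f a b.
Proof. by rewrite tens_lift_pi malg_liftU. Qed.

Lemma tens_lift_linear : linear tens_lift.
Proof.
move=> k; elim/quotm_ind=> u; elim/quotm_ind=> v.
by rewrite -linearP !tens_lift_pi linearP.
Qed.

Lemma tens_lift0 : tens_lift 0 = 0.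
Proof. by have := tens_lift_pi 0; rewrite !raddf0. Qed.
Lemma tens_liftD u v : tens_lift (u + v) = tens_lift u + tens_lift v.
Proof. by have := tens_lift_linear 1 u v; rewrite !scale1r. Qed.
Lemma tens_liftZ k u : tens_lift (k *: u) = k *: tens_lift u.
Proof. by have := tens_lift_linear k u 0; rewrite tens_lift0 !addr0. Qed.

End Lift.

End TensorModule.

Section TensorAlgebra.
Context (K : fieldType) (A B : algebra K).

Definition tens_mul_pure (a : A) (b : B) (a' : A) (b' : B) : tensm A B :=
  tensor (a * a') (b * b').

Local Notation mul_pure := tens_mul_pure.

Definition tens_mul : tensm A B -> tensm A B -> tensm A B :=
  locked_with quot_key
    (fun s t => tens_lift (fun a b => tens_lift (mul_pure a b) t) s).
Canonical tens_mul_unlockable := [unlockable fun tens_mul].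

Local Notation mul := tens_mul.

Let mul_pure_bilin a b : bilin (mul_pure a b).
Proof.
split=> [b' k u v|a' k u v]; rewrite /tens_mul_pure mulrDr.
  by rewrite -algZAr tensorDl tensorZl.
by rewrite -algZAr tensorDr tensorZr.
Qed.

Let mul_bilin t : bilin (fun a b => tens_lift (mul_pure a b) t).
Proof.
split=> [b k u v|a k u v]; elim/tens_ind: t => [a' b'||s t IHs IHt|c t IHt].
- rewrite !(tens_liftE (mul_pure_bilin _ _)) /tens_mul_pure.
  by rewrite mulrDl -algZAl tensorDl tensorZl.
- by rewrite !(tens_lift0 (mul_pure_bilin _ _)) scaler0 addr0.
- by rewrite !(tens_liftD (mul_pure_bilin _ _)) IHs IHt scalerDr addrACA.
- rewrite !(tens_liftZ (mul_pure_bilin _ _)) IHt.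
  by rewrite scalerDr !scalerA (mulrC c).
- rewrite !(tens_liftE (mul_pure_bilin _ _)) /tens_mul_pure.
  by rewrite mulrDl -algZAl tensorDr tensorZr.
- by rewrite !(tens_lift0 (mul_pure_bilin _ _)) scaler0 addr0.
- by rewrite !(tens_liftD (mul_pure_bilin _ _)) IHs IHt scalerDr addrACA.
- rewrite !(tens_liftZ (mul_pure_bilin _ _)) IHt.
  by rewrite scalerDr !scalerA (mulrC c).
Qed.

Let mulT a b t : mul (tensor a b) t = tens_lift (mul_pure a b) t.
Proof. by rewrite [mul]unlock (tens_liftE (mul_bilin t)). Qed.

Let mulE a b a' b' : mul (tensor a b) (tensor a' b') = tensor (a * a') (b * b').
Proof.
by rewrite mulT (tens_liftE (mul_pure_bilin _ _)).
Qed.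

Let mul0l t : mul 0 t = 0.
Proof. by rewrite [mul]unlock (tens_lift0 (mul_bilin t)). Qed.
Let mulDl : left_distributive mul +%R.
Proof. by move=> u v t; rewrite [mul]unlock (tens_liftD (mul_bilin t)). Qed.
Let mulZl k u t : k *: mul u t = mul (k *: u) t.
Proof. by rewrite [mul]unlock (tens_liftZ (mul_bilin t)). Qed.

Let mul0r t : mul t 0 = 0.
Proof.
elim/tens_ind: t => [a b||s t IHs IHt|k t IHt].
- by rewrite mulT (tens_lift0 (mul_pure_bilin _ _)).
- by rewrite mul0l.
- by rewrite mulDl IHs IHt addr0.
- by rewrite -mulZl IHt scaler0.
Qed.
Let mulDr : right_distributive mul +%R.
Proof.
move=> s u v; elim/tens_ind: s => [a b||s t IHs IHt|k t IHt].
- by rewrite !mulT (tens_liftD (mul_pure_bilin _ _)).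
- by rewrite !mul0l addr0.
- by rewrite !mulDl IHs IHt addrACA.
- by rewrite -!mulZl IHt scalerDr.
Qed.
Let mulZr k u t : k *: mul u t = mul u (k *: t).
Proof.
elim/tens_ind: u => [a b||s u IHs IHu|c u IHu].
- by rewrite !mulT (tens_liftZ (mul_pure_bilin _ _)).
- by rewrite !mul0l scaler0.
- by rewrite !mulDl -IHs -IHu scalerDr.
- by rewrite -!mulZl -IHu !scalerA mulrC.
Qed.

Let mulA : associative mul.
Proof.
move=> s t u; elim/tens_ind: s => [a b||s1 s2 IH1 IH2|k s IH].
- elim/tens_ind: t => [a' b'||t1 t2 IH1 IH2|k t IH].
  + elim/tens_ind: u => [a2 b2||u1 u2 IH1 IH2|k u IH].
    * by rewrite !mulE !mulrA.
    * by rewrite !mul0r.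
    * by rewrite !mulDr IH1 IH2.
    * by rewrite -!mulZr IH.
  + by rewrite !(mul0l, mul0r).
  + by rewrite !(mulDl, mulDr) IH1 IH2.
  + by rewrite -!(mulZl, mulZr) IH.
- by rewrite !mul0l.
- by rewrite !mulDl IH1 IH2.
- by rewrite -!mulZl IH.
Qed.

Let mul1l : left_id (tensor 1 1) mul.
Proof.
elim/tens_ind=> [a b||s t IHs IHt|k t IHt].
- by rewrite mulE !mul1r.
- by rewrite mul0r.
- by rewrite mulDr IHs IHt.
- by rewrite -mulZr IHt.
Qed.
Let mul1r : right_id (tensor 1 1) mul.
Proof.
elim/tens_ind=> [a b||s t IHs IHt|k t IHt].
- by rewrite mulE !mulr1.
- by rewrite mul0l.
- by rewrite mulDl IHs IHt.
- by rewrite -mulZl IHt.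
Qed.

Definition tens : algebra K :=
  Algebra mulA mul1l mul1r mulDl mulDr mulZl mulZr.

Lemma tensorM (a a' : A) (b b' : B) :
  (tensor a b : tens) * tensor a' b' = tensor (a * a') (b * b').
Proof. exact: mulE. Qed.

Lemma tensor11 : tensor 1 1 = 1 :> tens.
Proof. by []. Qed.

End TensorAlgebra.

Notation "a \ox b" := (tensor a b : tens _ _) (at level 40, left associativity).

Section Bialgebra.
Context (K : fieldType).

Definition tens_map (A B C D : algebra K) (f : A -> C) (g : B -> D) :
    tens A B -> tens C D :=
  tens_lift (fun a b => f a \ox g b).

Definition tens_assoc (A B C : algebra K) :
    tens (tens A B) C -> tens A (tens B C) :=
  tens_lift (fun (s : tens A B) c => tens_lift (fun a b => a \ox (b \ox c)) s).

(* The counit axioms are composed with the identifications of K (x) A and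
   A (x) K with A. *)
Definition is_bialgebra (A : algebra K) (D : A -> tens A A) (e : A -> K) : Prop :=
  [/\ alg_morphism D,
      scalar e /\ monoid_morphism e,
      forall a, tens_assoc (tens_map D id (D a)) = tens_map id D (D a),
      forall a, tens_lift (fun u v => e u *: v) (D a) = a &
      forall a, tens_lift (fun u v => e v *: u) (D a) = a].

Definition bialg_morphism (A B : algebra K)
    (DA : A -> tens A A) (eA : A -> K) (DB : B -> tens B B) (eB : B -> K)
    (f : A -> B) : Prop :=
  [/\ alg_morphism f,
      forall a, DB (f a) = tens_map f f (DA a) &
      forall a, eB (f a) = eA a].

End Bialgebra.

Section QNumbers.
Context (K : fieldType) (p : K).

Definition qint (n : nat) : K := \sum_(i < n) p ^+ i.
Definition qfact (n : nat) : K := \prod_(i < n) qint i.+1.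
(* meaningful when r <= n and no qint vanishes *)
Definition qbinom (n r : nat) : K := qfact n / (qfact r * qfact (n - r)).

End QNumbers.

Definition generic (K : fieldType) (q : K) : Prop :=
  forall n, (0 < n)%N -> qint (q ^+ 2) n != 0.

(* M0 is the restricted comeasuring bialgebra of the plane and M0D its quotient
   respecting the braided coaddition. *)
Section Comeasuring.
Context (K : fieldType) (q : K).

(* (m, n) is the index of the basis element x^m y^n of the plane *)
Local Notation idx := (nat * nat)%type.

Local Notation t I J := (freegen K (I : idx, J : idx)).

(* In the sums (c, d) = (m - a, n - b). *)
Variant M0_rel : freealg K (idx * idx)%type -> Prop :=
| M0_rel_mul m n i j k l : M0_rel
    (\sum_(a < m.+1) \sum_(b < n.+1)
        q ^+ (b * (m - a)) *: (t (a : nat, b : nat) (i, j) *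
                               t ((m - a)%N, (n - b)%N) (k, l))
     - q ^+ (j * k) *: t (m, n) ((i + k)%N, (j + l)%N))
| M0_rel_one : M0_rel (t (0, 0)%N (0, 0)%N - 1)
| M0_rel_up J : J != (0, 0)%N -> M0_rel (t (0, 0)%N J)
| M0_rel_low I : I != (0, 0)%N -> M0_rel (t I (0, 0)%N).

Definition M0 : algebra K := quota (genideal M0_rel).

Definition M0_t (I J : idx) : M0 := quota_pi (genideal M0_rel) (t I J).

(* \sum_(L \in _) is the sum over the finite support: M0_t I L = 0 whenever
   L.1 + L.2 > I.1 + I.2. *)
Definition M0_bialgebra (D : M0 -> tens M0 M0) (e : M0 -> K) : Prop :=
  [/\ is_bialgebra D e,
      forall I J, D (M0_t I J) = \sum_(L \in [set: idx]) M0_t I L \ox M0_t L J &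
      forall I J, e (M0_t I J) = (I == J)%:R].

(* Coefficient of e_A (x) e_B in the braided coaddition of e_M; with M = (m, n)
   and A = (r, s) it is q^((m - r) s) times the q^2-binomials of (m, r), (n, s). *)
Definition coadd_coef (M A B : idx) : K :=
  if ((A.1 + B.1)%N, (A.2 + B.2)%N) == M then
    qbinom (q ^+ 2) M.1 A.1 * qbinom (q ^+ 2) M.2 A.2 * q ^+ (B.1 * A.2)
  else 0.

(* d i j k is the coefficient of e_j (x) e_k in the coproduct of e_i; for each
   relation both sums must have finite support. *)
Variant respect_rel (A : algebra K) (I : choiceType) (d : I -> I -> I -> K)
    (u : I -> I -> A) : A -> Prop :=
| RespectRel i j k : respect_rel d u
    (\sum_(a \in [set: I]) d a j k *: u a i
     - \sum_(ab \in [set: I * I]) d i ab.1 ab.2 *: (u j ab.1 * u k ab.2)).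

Definition M0D_rel : M0 -> Prop := respect_rel coadd_coef M0_t.

Definition M0D : algebra K := quota (genideal M0D_rel).

Definition M0D_pi : M0 -> M0D := quota_pi (genideal M0D_rel).

Definition M0D_t (I J : idx) : M0D := M0D_pi (M0_t I J).

Definition M0D_bialgebra (D0 : M0 -> tens M0 M0) (e0 : M0 -> K)
    (D : M0D -> tens M0D M0D) (e : M0D -> K) : Prop :=
  is_bialgebra D e /\ bialg_morphism D0 e0 D e M0D_pi.

(* The two sides of respect_rel coadd_coef with their supports made explicit. *)
Lemma coadd_rel_lhs (u : idx -> idx -> M0) m n i j k l :
  \sum_(a \in [set: idx]) coadd_coef a (i, j) (k, l) *: u a (m, n) =
  (qbinom (q ^+ 2) (i + k) i * qbinom (q ^+ 2) (j + l) j * q ^+ (j * k))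
    *: u ((i + k)%N, (j + l)%N) (m, n).
Proof.
rewrite -(fsbig_widen [set ((i + k)%N, (j + l)%N)]) //.
  by rewrite fsbig_set1 /coadd_coef /= eqxx mulnC.
move=> a [_ /eqP neq] /=; rewrite /coadd_coef /= eq_sym.
by rewrite (negPf neq) scale0r.
Qed.

Lemma coadd_rel_rhs (u : idx -> idx -> M0) m n i j k l :
  \sum_(ab \in [set: idx * idx])
     coadd_coef (m, n) ab.1 ab.2 *: (u (i, j) ab.1 * u (k, l) ab.2) =
  \sum_(a < m.+1) \sum_(b < n.+1)
     (qbinom (q ^+ 2) m a * qbinom (q ^+ 2) n b * q ^+ (b * (m - a)))
       *: (u (i, j) (a : nat, b : nat) * u (k, l) ((m - a)%N, (n - b)%N)).
Proof.
pose h a b : idx * idx := ((a, b), ((m - a)%N, (n - b)%N)).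
pose r := [seq h a b | a <- iota 0 m.+1, b <- iota 0 n.+1].
have r_uniq : uniq r.
  apply: allpairs_uniq; rewrite ?iota_uniq // => -[a b] [a' b'] _ _ /=.
  by case=> -> ->.
rewrite -(fsbig_widen [set` r]) //; last first.
  move=> [[a b] [c d]] [_ notr] /=; rewrite /coadd_coef /=.
  case: eqP => [[em en]|]; last by rewrite scale0r.
  case: notr => /=; apply/allpairsP; exists (a, b).
  by rewrite !mem_iota !add0n !ltnS -em -en !leq_addr /h -em -en !addKn.
rewrite -(fsbig_seq _ _ r_uniq) big_allpairs_dep -[iota 0 m.+1]/(index_iota 0 m.+1).
rewrite big_mkord; apply: eq_bigr => a _.
rewrite -[iota 0 n.+1]/(index_iota 0 n.+1) big_mkord; apply: eq_bigr => b _.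
by rewrite /coadd_coef /= !subnKC ?leq_ord // eqxx mulnC.
Qed.

End Comeasuring.

Section QuantumMatrices.
Context (K : fieldType) (q : K).

Local Notation u i j := (freegen K (i : 'I_2, j : 'I_2)).
Local Notation a := (u 0 0).
Local Notation b := (u 0 1).
Local Notation c := (u 1 0).
Local Notation d := (u 1 1).

Variant Mq2_rel : freealg K ('I_2 * 'I_2)%type -> Prop :=
| Mq2_ba : Mq2_rel (b * a - q *: (a * b))
| Mq2_ca : Mq2_rel (c * a - q *: (a * c))
| Mq2_dc : Mq2_rel (d * c - q *: (c * d))
| Mq2_db : Mq2_rel (d * b - q *: (b * d))
| Mq2_bc : Mq2_rel (b * c - c * b)
| Mq2_ad : Mq2_rel (a * d - d * a - (q^-1 - q) *: (b * c)).

Definition Mq2 : algebra K := quota (genideal Mq2_rel).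

Definition Mq2_u (i j : 'I_2) : Mq2 := quota_pi (genideal Mq2_rel) (u i j).

Definition Mq2_bialgebra (D : Mq2 -> tens Mq2 Mq2) (e : Mq2 -> K) : Prop :=
  [/\ is_bialgebra D e,
      forall i j, D (Mq2_u i j) = \sum_(k < 2) Mq2_u i k \ox Mq2_u k j &
      forall i j, e (Mq2_u i j) = (i == j)%:R].

End QuantumMatrices.

(* Main.v *)
Require Import Defs.
From HB Require Import structures.
From mathcomp Require Import all_boot all_order all_algebra.
From mathcomp Require Import generic_quotient ring zify.
From mathcomp Require Import boolp classical_sets fsbigop reals complex.
From mathcomp.multinomials Require Import monalg.

(* M_0(C_q^2) is universal for the families t making e_J |-> sum_I e_I (x) t^I_J
   an algebra map. Up to rescaling by q-factorials, the algebra dual to the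
   coaddition is again the quantum plane, so respecting the coaddition means
   that the transposed family, rescaled, satisfies the same product relations.
   In degree two these two families of relations are exactly those of M_q(2).
   Conversely, over M_q(2) the map x |-> x a + y c, y |-> x b + y d extends to
   an algebra map, which defines t; the q-binomial theorem gives t^I_J in closed
   form, [J]! times a sum that is invariant under exchanging both I with J and
   b with c. As this exchange preserves the relations of M_q(2), the transposed
   relations follow from the direct ones. *)

Set Implicit Arguments.
Unset Strict Implicit.
Unset Printing Implicit Defensive.

Import GRing.Theory.

Local Open Scope ring_scope.

(** * Presentations by generators and relations *)

(** No basis or normal form of [M0D q] or [Mq2 q] is computed. Both are handled through universal
    properties alone: a map out of them exists once the relations hold in the target, and two maps
    agree once they agree on generators. Coproducts, counits and both halves of the isomorphism
    arise this way, so the work lies in exhibiting comeasuring families. The difficulty is that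
    [M0 q] has infinitely many generators. The columns of [x] and [y] determine the others, since
    products of basis elements have nonzero coefficients; but these two columns could still have
    entries in every positive degree, because the relations of [M0 q] only force [t^I_J = 0] for
    [|I| < |J|]. The transposed relations force the opposite vanishing, and four generators remain.
    Genericity makes the q-factorials invertible; its case [1 + q^2 != 0] makes [b] and [c] commute.
    The closed form is unavoidable in this approach: the coaction is multiplicative in the column
    index by construction, while nothing in its definition shows any relation between rows. *)

Section Morphisms.
Context (K : fieldType) (A B : algebra K) (f : A -> B) (hf : alg_morphism f).

Lemma morphD u v : f (u + v) = f u + f v.
Proof. by have := hf.1 1 u v; rewrite !scale1r. Qed.

Lemma morph0 : f 0 = 0.
Proof. by apply: (addrI (f 0)); rewrite -morphD !addr0. Qed.

Lemma morphZ k u : f (k *: u) = k *: f u.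
Proof. by have := hf.1 k u 0; rewrite morph0 !addr0. Qed.

Lemma morphN u : f (- u) = - f u.
Proof. by rewrite -scaleN1r morphZ scaleN1r. Qed.

Lemma morphB u v : f (u - v) = f u - f v.
Proof. by rewrite morphD morphN. Qed.

Lemma morph1 : f 1 = 1. Proof. exact: hf.2.1. Qed.

Lemma morphM u v : f (u * v) = f u * f v. Proof. exact: hf.2.2. Qed.

Lemma morph_sum I (r : seq I) (P : pred I) (E : I -> A) :
  f (\sum_(i <- r | P i) E i) = \sum_(i <- r | P i) f (E i).
Proof. exact: (big_morph f morphD morph0). Qed.

End Morphisms.

Lemma morph_id (K : fieldType) (A : algebra K) : alg_morphism (@id A).
Proof. by do 2!split. Qed.

Lemma morph_comp (K : fieldType) (A B C : algebra K) (f : A -> B) (g : B -> C) :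
  alg_morphism f -> alg_morphism g -> alg_morphism (fun x => g (f x)).
Proof.
move=> hf hg; split=> [k u v|].
  by rewrite (morphD hf) (morphZ hf) (morphD hg) (morphZ hg).
split; first by rewrite (morph1 hf) (morph1 hg).
by move=> u v; rewrite (morphM hf) (morphM hg).
Qed.

(** Encoded as uniqueness of algebra maps with given values on [x]: this is the form in which
    generation is applied, and it passes to quotients at once. *)
Definition generates (K : fieldType) (A : algebra K) (X : Type) (x : X -> A) :=
  forall (B : algebra K) (f g : A -> B), alg_morphism f -> alg_morphism g ->
    (forall i, f (x i) = g (x i)) -> forall u, f u = g u.

(* Stated over an arbitrary algebra in order to keep the product of the free
   algebra from being unfolded during unification. *)
Lemma multiplicative_on_words (K : fieldType) (A B : algebra K) (X : Type)
    (x : X -> A) (f : X -> B) (F : A -> B) :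
    (forall P : A -> Prop, P 1 -> (forall i u, P u -> P (x i * u)) -> P 0 ->
      (forall u v, P u -> P v -> P (u + v)) ->
      (forall k u, P u -> P (k *: u)) -> forall u, P u) ->
  linear F -> F 1 = 1 -> (forall i u, F (x i * u) = f i * F u) ->
  alg_morphism F.
Proof.
move=> ind FP F1 FxM; split=> //; split=> // u v.
have FD w w' : F (w + w') = F w + F w'.
  by have := FP 1 w w'; rewrite !scale1r.
have F0 : F 0 = 0 by apply: (addrI (F 0)); rewrite -FD !addr0.
have FZ k w : F (k *: w) = k *: F w by have := FP k w 0; rewrite F0 !addr0.
elim/ind: u => [|i u ih||u w hu hw|k u ih].
- by rewrite F1 !mul1r.
- by rewrite -mulrA !FxM ih mulrA.
- by rewrite mul0r F0 mul0r.
- by rewrite mulrDl !FD hu hw mulrDl.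
- by rewrite -algZAl !FZ ih algZAl.
Qed.

Section Presentation.
Context (K : fieldType) (X : choiceType).

Lemma freegenM x (s : seq X) :
  freegen K x * << FMonom s >> = << FMonom (x :: s) >> :> freealg K X.
Proof.
rewrite [LHS](fgmulUU 1 1 (fmu x) (FMonom s)) mulr1; congr << _ >>.
by rewrite [LHS]fmmulE fmuE.
Qed.

Lemma malgUZ c (m : {fmonom X}) :
  << c *g m >> = c *: << m >> :> {malg K[{fmonom X}]}.
Proof. by apply/malgP=> k; rewrite mcoeffZ mcoeffU1 mcoeffU mulr_natr. Qed.

Lemma freealg_ind (P : freealg K X -> Prop) :
    P 1 -> (forall x u, P u -> P (freegen K x * u)) -> P 0 ->
    (forall u v, P u -> P v -> P (u + v)) ->
    (forall k u, P u -> P (k *: u)) ->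
  forall u, P u.
Proof.
move=> h1 hx h0 hD hZ u; rewrite [u]monalgE; elim/big_ind: _ => // m _.
rewrite malgUZ; apply: (hZ); case: m => s; elim: s => [|x s ih].
  by rewrite -fmoneE.
by rewrite -freegenM; apply: hx.
Qed.

Lemma freealg_lift (B : algebra K) (f : X -> B) :
  exists F : freealg K X -> B, alg_morphism F /\ forall x, F (freegen K x) = f x.
Proof.
pose g (m : {fmonom X}) := \prod_(x <- (m : seq X)) f x.
pose F : freealg K X -> B := malg_lift g.
have FD u v : F (u + v) = F u + F v by apply: (raddfD (malg_lift g)).
have F0 : F 0 = 0 by apply: (raddf0 (malg_lift g)).
have FZ k u : F (k *: u) = k *: F u.
  by have := malg_lift_linear g k u 0; rewrite [malg_lift g 0]F0 !addr0.
have Fx x : F (freegen K x) = f x.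
  by rewrite [LHS]malg_liftU /g fmuE /= big_seq1.
have F1 : F 1 = 1.
  have -> : 1 = << FMonom [::] >> :> freealg K X by rewrite -fmoneE.
  by rewrite [LHS]malg_liftU /g /= big_nil.
have FxM x u : F (freegen K x * u) = f x * F u.
  rewrite [u]monalgE mulr_sumr !(big_morph F FD F0) mulr_sumr.
  apply: eq_bigr => m _.
  rewrite malgUZ -[_ *: _]/(_ *: (_ : freealg K X)) -(algZAr _ (freegen K x)).
  rewrite !FZ -algZAr.
  congr (_ *: _); case: m => s; rewrite freegenM /F !malg_liftU /g /=.
  by rewrite big_cons.
exists F; split=> //; apply: (multiplicative_on_words freealg_ind) F1 FxM.
by move=> k u v; rewrite FD FZ.
Qed.

Context (S : freealg K X -> Prop).

Lemma pres_generates :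
  generates (fun x => quota_pi (genideal S) (freegen K x)).
Proof.
move=> B f g hf hg e; elim/quota_ind.
have hp := @quota_pi_morphism _ _ (genideal S).
have hfp := morph_comp hp hf; have hgp := morph_comp hp hg.
elim/freealg_ind => [|x u ih||u v hu hv|k u ih].
- by rewrite (morph1 hfp) (morph1 hgp).
- by rewrite (morphM hfp) (morphM hgp) ih e.
- by rewrite (morph0 hfp) (morph0 hgp).
- by rewrite (morphD hfp) (morphD hgp) hu hv.
- by rewrite (morphZ hfp) (morphZ hgp) ih.
Qed.

End Presentation.

Section QuotientLift.
Context (K : fieldType) (A B : algebra K) (S : A -> Prop) (f : A -> B).
Hypotheses (hf : alg_morphism f) (fS : forall s, S s -> f s = 0).

Let kerD u v : f u = 0 -> f v = 0 -> f (u + v) = 0.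
Proof. by rewrite (morphD hf) => -> ->; rewrite addr0. Qed.
Let kerZ k u : f u = 0 -> f (k *: u) = 0.
Proof. by rewrite (morphZ hf) => ->; rewrite scaler0. Qed.
Let kerMl a u : f u = 0 -> f (a * u) = 0.
Proof. by rewrite (morphM hf) => ->; rewrite mulr0. Qed.
Let kerMr a u : f u = 0 -> f (u * a) = 0.
Proof. by rewrite (morphM hf) => ->; rewrite mul0r. Qed.

Lemma quota_lift : exists F : quota (genideal S) -> B,
  alg_morphism F /\ forall u, F (quota_pi (genideal S) u) = f u.
Proof.
(* The kernel of [f] is an ideal containing [S], hence contains the generated one, so [f] takes the
   same value on all representatives of a class. *)
pose ker := @Ideal _ _ (Subspace (morph0 hf) kerD kerZ) kerMl kerMr.
pose p := quota_pi (genideal S).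
pose F (x : quota (genideal S)) := f (repr (x : quotm (genideal S))).
have Fp u : F (p u) = f u.
  have /quotm_piP : quotm_pi (genideal S) (repr (p u : quotm (genideal S))) = p u.
    exact: quotm_reprK.
  by move/(_ ker) => /(_ fS); rewrite /= (morphB hf) => /subr0_eq.
have hp := @quota_pi_morphism _ _ (genideal S).
exists F; split=> //; split; last split.
- move=> k; elim/quota_ind=> u; elim/quota_ind=> v.
  by rewrite -/p -(morphZ hp) -(morphD hp) !Fp (morphD hf) (morphZ hf).
- by rewrite -(morph1 hp) Fp (morph1 hf).
- elim/quota_ind=> u; elim/quota_ind=> v.
  by rewrite -(morphM hp) !Fp (morphM hf).
Qed.

End QuotientLift.

Lemma quota_generates (K : fieldType) (A : algebra K) (S : A -> Prop)
    (X : Type) (x : X -> A) :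
  generates x -> generates (fun i => quota_pi (genideal S) (x i)).
Proof.
move=> hx B f g hf hg e; elim/quota_ind.
have hp := @quota_pi_morphism _ _ (genideal S).
by apply: hx; [apply: morph_comp hp hf | apply: morph_comp hp hg |].
Qed.

(** * Morphisms between tensor products *)

Section Tensor.
Context (K : fieldType).
Implicit Types (A B C D : algebra K).

Lemma tensor_bilin A B : bilin (fun (a : A) (b : B) => a \ox b).
Proof.
by split=> [b|a] k u v; rewrite ?(tensorDl, tensorDr) ?(tensorZl, tensorZr).
Qed.

Lemma tensor0l A B (b : B) : (0 : A) \ox b = 0.
Proof. by rewrite -(scale0r (0 : A)) tensorZl scale0r. Qed.

Lemma tensor0r A B (a : A) : a \ox (0 : B) = 0.
Proof. by rewrite -(scale0r (0 : B)) tensorZr scale0r. Qed.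

Lemma tensor_suml A B (I : Type) (r : seq I) (P : pred I) (E : I -> A) (b : B) :
  (\sum_(i <- r | P i) E i) \ox b = \sum_(i <- r | P i) E i \ox b.
Proof.
apply: (big_morph (fun a => a \ox b)); last exact: tensor0l.
by move=> u v; apply: tensorDl.
Qed.

Lemma tensor_sumr A B (I : Type) (r : seq I) (P : pred I) (a : A) (E : I -> B) :
  a \ox (\sum_(i <- r | P i) E i) = \sum_(i <- r | P i) a \ox E i.
Proof.
apply: (big_morph (fun b => a \ox b)); last exact: tensor0r.
by move=> u v; apply: tensorDr.
Qed.

Lemma tens_lift_morphism A B C (h : A -> B -> C) :
    bilin h -> h 1 1 = 1 ->
    (forall a a' b b', h (a * a') (b * b') = h a b * h a' b') ->
  alg_morphism (tens_lift h : tens A B -> C).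
Proof.
move=> hb h1 hM; split; first exact: tens_lift_linear.
split; first by rewrite -tensor11 tens_liftE.
have hD := tens_liftD hb; have hZ := tens_liftZ hb; have h0 := tens_lift0 hb.
move=> s t; elim/tens_ind: s => [a b||s s' ihs ihs'|k s ih].
- elim/tens_ind: t => [a' b'||t t' iht iht'|k t ih].
  + by rewrite tensorM !tens_liftE.
  + by rewrite mulr0 h0 mulr0.
  + by rewrite mulrDr !hD iht iht' mulrDr.
  + by rewrite -[_ * _]algZAr !hZ ih algZAr.
- by rewrite mul0r h0 mul0r.
- by rewrite mulrDl !hD ihs ihs' mulrDl.
- by rewrite -[_ * _]algZAl !hZ ih algZAl.
Qed.

Section Map.
Context (A B C D : algebra K) (f : A -> C) (g : B -> D).
Context (hf : alg_morphism f) (hg : alg_morphism g).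

Let map_bilin : bilin (fun a b => f a \ox g b).
Proof.
split=> [b|a] k u v.
  by rewrite (morphD hf) (morphZ hf) tensorDl tensorZl.
by rewrite (morphD hg) (morphZ hg) tensorDr tensorZr.
Qed.

Lemma tens_mapE a b : tens_map f g (a \ox b) = f a \ox g b.
Proof. by rewrite /tens_map (tens_liftE map_bilin). Qed.

Lemma tens_map_morphism : alg_morphism (tens_map f g).
Proof.
apply: tens_lift_morphism => // [|a a' b b'].
  by rewrite (morph1 hf) (morph1 hg).
by rewrite tensorM (morphM hf) (morphM hg).
Qed.

End Map.

Lemma tens_map_comp A B A' B' A'' B'' (f : A -> A') (g : B -> B')
    (f' : A' -> A'') (g' : B' -> B'') :
    alg_morphism f -> alg_morphism g -> alg_morphism f' -> alg_morphism g' ->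
  forall t : tens A B, tens_map f' g' (tens_map f g t) =
    tens_map (fun a => f' (f a)) (fun b => g' (g b)) t.
Proof.
move=> hf hg hf' hg'.
have h := tens_map_morphism hf hg; have h' := tens_map_morphism hf' hg'.
have h2 := tens_map_morphism (morph_comp hf hf') (morph_comp hg hg').
elim/tens_ind => [a b||s t ihs iht|k t ih].
- by rewrite !tens_mapE //; apply: morph_comp.
- by rewrite (morph0 h) (morph0 h') (morph0 h2).
- by rewrite (morphD h) (morphD h') (morphD h2) ihs iht.
- by rewrite (morphZ h) (morphZ h') (morphZ h2) ih.
Qed.

Lemma tens_map_id A B (t : tens A B) (f : A -> A) (g : B -> B) :
  f =1 id -> g =1 id -> tens_map f g t = t.
Proof.
move=> /funext -> /funext ->; have h := tens_map_morphism (morph_id A) (morph_id B).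
elim/tens_ind: t => [a b||s t ihs iht|k t ih].
- by rewrite (tens_mapE (morph_id A) (morph_id B)).
- exact: morph0 h.
- by rewrite (morphD h) ihs iht.
- by rewrite (morphZ h) ih.
Qed.

(* Trilinear maps, kept abstract: unification between iterated tensors is
   very slow. *)
Section Trilinear.
Context (A B C E : algebra K) (h : C -> A -> B -> E).
Context (hb : forall c, bilin (h c)) (hC : forall a b, linear (fun c => h c a b)).

Let hD c := tens_liftD (hb c).
Let hZ c := tens_liftZ (hb c).
Let h0 c := tens_lift0 (hb c).

Lemma trilin_bilin : bilin (fun (s : tens A B) (c : C) => tens_lift (h c) s).
Proof.
split=> [c|s k u v]; first exact: tens_lift_linear.
elim/tens_ind: s => [a b||s t ihs iht|l t ih].
- by rewrite !(tens_liftE (hb _)) hC.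
- by rewrite !h0 scaler0 addr0.
- by rewrite !hD ihs iht scalerDr addrACA.
- by rewrite !hZ ih scalerDr !scalerA (mulrC l).
Qed.

Lemma trilinE a b c :
  tens_lift (fun (s : tens A B) (c : C) => tens_lift (h c) s) ((a \ox b) \ox c) =
  h c a b.
Proof. by rewrite (tens_liftE trilin_bilin) (tens_liftE (hb c)). Qed.

Lemma trilin_morphism : h 1 1 1 = 1 ->
    (forall a a' b b' c c',
      h (c * c') (a * a') (b * b') = h c a b * h c' a' b') ->
  alg_morphism (tens_lift (fun (s : tens A B) (c : C) => tens_lift (h c) s)
                : tens (tens A B) C -> E).
Proof.
move=> h1 hM; apply: tens_lift_morphism trilin_bilin _ _ => [|s s' c c'].
  by rewrite -tensor11 (tens_liftE (hb 1)).
elim/tens_ind: s => [a b||s t ihs iht|k s ih].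
- elim/tens_ind: s' => [a' b'||t t' iht iht'|k t ih].
  + by rewrite tensorM !(tens_liftE (hb _)).
  + by rewrite mulr0 !h0 mulr0.
  + by rewrite mulrDr !hD iht iht' mulrDr.
  + by rewrite -(@algZAr _ (tens A B) k (a \ox b) t) !hZ ih algZAr.
- by rewrite mul0r !h0 mul0r.
- by rewrite mulrDl !hD ihs iht mulrDl.
- by rewrite -(@algZAl _ (tens A B) k s s') !hZ ih algZAl.
Qed.

End Trilinear.

Section Assoc.
Context (A B C : algebra K).

Let h (c : C) (a : A) (b : B) : tens A (tens B C) := a \ox (b \ox c).

Let h_bilin c : bilin (h c).
Proof.
split=> [b|a] k u v; rewrite /h ?tensorDl ?tensorZl //.
by rewrite tensorDr tensorZr.
Qed.

Let h_linear a b : linear (fun c => h c a b).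
Proof.
by move=> k u v; rewrite /h (tensorDr b) (tensorZr k b) tensorDr tensorZr.
Qed.

Lemma tens_assocE (a : A) (b : B) (c : C) :
  tens_assoc ((a \ox b) \ox c) = a \ox (b \ox c).
Proof. exact: (trilinE h_bilin h_linear). Qed.

Lemma tens_assoc_morphism : alg_morphism (@tens_assoc K A B C).
Proof.
apply: (trilin_morphism h_bilin h_linear) => [|a a' b b' c c'].
  by rewrite /h !tensor11.
by rewrite /h !tensorM.
Qed.

End Assoc.

Fact base_mulrC_scale (k u v : K) : k * (u * v) = u * (k * v).
Proof. exact: mulrCA. Qed.

(** The ground field as an algebra over itself, so that counits are algebra morphisms and come from
    the same universal properties as coproducts. *)
Definition base_alg : algebra K :=
  @Algebra K K^o 1 *%R (@mulrA K) (@mul1r K) (@mulr1 K) (@mulrDl K) (@mulrDr K)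
    (@mulrA K) base_mulrC_scale.

Section Counit.
Context (A : algebra K) (e : A -> K).
Context (he : alg_morphism (e : A -> base_alg)).

Let eD u v : e (u + v) = e u + e v. Proof. exact: (morphD he). Qed.
Let eZ k u : e (k *: u) = k * e u. Proof. exact: (morphZ he). Qed.
Let e1 : e 1 = 1. Proof. exact: (morph1 he). Qed.
Let eM u v : e (u * v) = e u * e v. Proof. exact: (morphM he). Qed.

Let counitl_bilin : bilin (fun u v : A => e u *: v).
Proof.
split=> [b|a] k u v; first by rewrite eD eZ scalerDl scalerA.
by rewrite scalerDr !scalerA mulrC.
Qed.

Let counitr_bilin : bilin (fun u v : A => e v *: u).
Proof.
split=> [b|a] k u v; last by rewrite eD eZ scalerDl scalerA.
by rewrite scalerDr !scalerA mulrC.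
Qed.

Lemma counitlE u v : tens_lift (fun u v : A => e u *: v) (u \ox v) = e u *: v.
Proof. by rewrite (tens_liftE counitl_bilin). Qed.

Lemma counitrE u v : tens_lift (fun u v : A => e v *: u) (u \ox v) = e v *: u.
Proof. by rewrite (tens_liftE counitr_bilin). Qed.

Lemma counitl_morphism :
  alg_morphism (tens_lift (fun u v : A => e u *: v) : tens A A -> A).
Proof.
apply: tens_lift_morphism => // [|a a' b b']; first by rewrite e1 scale1r.
by rewrite eM -algZAl -algZAr scalerA.
Qed.

Lemma counitr_morphism :
  alg_morphism (tens_lift (fun u v : A => e v *: u) : tens A A -> A).
Proof.
apply: tens_lift_morphism => // [|a a' b b']; first by rewrite e1 scale1r.
by rewrite eM -algZAl -algZAr scalerA.
Qed.

End Counit.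

(* For an algebra generated by a matrix x whose rows have finite support: r i
   lists a set containing the support of row i and of all the rows it meets. *)
Lemma matrix_bialgebra A (I : eqType) (x : I -> I -> A) (r : I -> seq I)
    (D : A -> tens A A) (e : A -> base_alg) :
    generates (fun p : I * I => x p.1 p.2) ->
    (forall i, uniq (r i)) -> (forall i k, k \notin r i -> x i k = 0) ->
    (forall i k, k \in r i -> {subset r k <= r i}) ->
    alg_morphism D -> alg_morphism e ->
    (forall i j, D (x i j) = \sum_(k <- r i) x i k \ox x k j) ->
    (forall i j, e (x i j) = (i == j)%:R) ->
  is_bialgebra D e.
Proof.
move=> hx ru r0 rS hD he Dx ex.
have hid := morph_id A.
have mD1 := tens_map_morphism hD hid; have mD2 := tens_map_morphism hid hD.
have ha := @tens_assoc_morphism A A A.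
have sum1 (V : zmodType) (s : seq I) i (E : I -> V) : uniq s ->
    \sum_(k <- s | k == i) E k = if i \in s then E i else 0.
  move=> us; case: ifP => [si|/negbT si].
    by rewrite -big_filter filter_pred1_uniq // big_seq1.
  by rewrite big_seq_cond big1 // => k /andP[ks /eqP ki]; move: si; rewrite -ki ks.
split=> //.
- have /= := hx _ _ _ (morph_comp (morph_comp hD mD1) ha) (morph_comp hD mD2).
  apply.
  move=> [i j] /=; rewrite Dx (morph_sum mD1) (morph_sum ha) (morph_sum mD2).
  under eq_bigr do rewrite (tens_mapE hD hid) Dx tensor_suml (morph_sum ha).
  under [RHS]eq_bigr do rewrite (tens_mapE hid hD) Dx tensor_sumr.
  rewrite exchange_big /= big_seq [RHS]big_seq; apply: eq_bigr => l li.
  under eq_bigr do rewrite tens_assocE.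
  (* The inner sum still ranges over [r i]; it shrinks to the subset [r l] because [x l k] vanishes
     for [k] outside [r l]. *)
  rewrite (bigID (mem (r l))) /= [X in _ + X]big1 ?addr0 => [|k nk]; last first.
    by rewrite (r0 _ _ nk) tensor0l tensor0r.
  rewrite -big_filter; apply/perm_big/uniq_perm => //; first exact/filter_uniq/ru.
  move=> k; rewrite mem_filter; apply: andb_idr; exact: rS li _.
- have /= := hx _ _ _ (morph_comp hD (counitl_morphism he)) hid; apply.
  move=> [i j] /=; rewrite Dx (morph_sum (counitl_morphism he)).
  under eq_bigr do rewrite (counitlE he) ex eq_sym scaler_nat mulrb.
  rewrite -big_mkcond sum1 //; case: ifP => // /negbT /r0 xi0.
  (* If [i] were missing from [r i], then [x i i] would be zero, whereas the counit sends it to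
     1. *)
  by have := ex i i; rewrite eqxx xi0 (morph0 he) => /esym/eqP; rewrite oner_eq0.
- have /= := hx _ _ _ (morph_comp hD (counitr_morphism he)) hid; apply.
  move=> [i j] /=; rewrite Dx (morph_sum (counitr_morphism he)).
  under eq_bigr do rewrite (counitrE he) ex scaler_nat mulrb.
  rewrite -big_mkcond sum1 //; case: ifP => // /negbT /r0 -> //.
Qed.

End Tensor.

(** * Comeasuring families *)

Section Indices.

Definition iadd (I J : nat * nat) : nat * nat := ((I.1 + J.1)%N, (I.2 + J.2)%N).
Definition wt (I : nat * nat) : nat := (I.1 + I.2)%N.
Definition tri (n : nat) : seq (nat * nat) :=
  [seq I <- [seq (a, b) | a <- iota 0 n.+1, b <- iota 0 n.+1] | (wt I <= n)%N].
Definition splits (M : nat * nat) : seq ((nat * nat) * (nat * nat)) :=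
  [seq ((a, b), ((M.1 - a)%N, (M.2 - b)%N))
   | a <- iota 0 M.1.+1, b <- iota 0 M.2.+1].

Lemma wtD I J : wt (iadd I J) = (wt I + wt J)%N.
Proof. by rewrite /wt /= addnACA. Qed.

Lemma wt_eq0 I : (wt I == 0%N) = (I == (0, 0)%N).
Proof. by case: I => a b; rewrite /wt addn_eq0 xpair_eqE. Qed.

Lemma mem_tri n I : (I \in tri n) = (wt I <= n)%N.
Proof.
rewrite mem_filter andb_idr // => le; apply/allpairsP; exists I.
rewrite !mem_iota !ltnS /= !(leq_trans _ le) ?leq_addl ?leq_addr //.
by case: I {le}.
Qed.

Lemma tri_uniq n : uniq (tri n).
Proof.
apply/filter_uniq/allpairs_uniq; rewrite ?iota_uniq // => -[a b] [a' b'] _ _ /=.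
by case=> -> ->.
Qed.

Lemma mem_splits M p : (p \in splits M) = (iadd p.1 p.2 == M).
Proof.
apply/allpairsP/eqP => [[[a b]]|<-].
  rewrite !mem_iota !add0n !ltnS => -[ha hb ->].
  by rewrite /iadd /= !subnKC //; case: M {ha hb}.
case: p => [[a b] [c d]]; exists (a, b).
by rewrite !mem_iota !add0n !ltnS !leq_addr !addKn.
Qed.

Lemma splits_uniq M : uniq (splits M).
Proof.
apply: allpairs_uniq; rewrite ?iota_uniq // => -[a b] [a' b'] _ _ /=.
by case=> -> ->.
Qed.

Lemma sum_splits (V : nmodType) (M : nat * nat) (F : nat * nat -> nat * nat -> V) :
  \sum_(p <- splits M) F p.1 p.2 =
  \sum_(a < M.1.+1) \sum_(b < M.2.+1)
    F (a : nat, b : nat) ((M.1 - a)%N, (M.2 - b)%N).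
Proof.
rewrite big_allpairs_dep -[iota 0 M.1.+1]/(index_iota 0 M.1.+1) big_mkord.
apply: eq_bigr => a _.
by rewrite -[iota 0 M.2.+1]/(index_iota 0 M.2.+1) big_mkord.
Qed.

Lemma sum_tri_widen (V : nmodType) (n N : nat) (F : nat * nat -> V) :
    (n <= N)%N -> (forall I, (n < wt I)%N -> F I = 0) ->
  \sum_(I <- tri N) F I = \sum_(I <- tri n) F I.
Proof.
move=> le F0; rewrite (bigID (fun I => wt I <= n)%N) /= [X in _ + X]big1 ?addr0.
  rewrite -big_filter; apply/perm_big/uniq_perm.
  - exact/filter_uniq/tri_uniq.
  - exact: tri_uniq.
  - by move=> I; rewrite mem_filter !mem_tri andb_idr // => /leq_trans; apply.
by move=> I; rewrite -ltnNge => /F0.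
Qed.

Lemma sum_tri_splits (V : nmodType) (N : nat) (F : nat * nat -> nat * nat -> V) :
    (forall I J, (N < wt I + wt J)%N -> F I J = 0) ->
  \sum_(I <- tri N) \sum_(J <- tri N) F I J =
  \sum_(M <- tri N) \sum_(p <- splits M) F p.1 p.2.
Proof.
move=> F0; pose G p := F p.1 p.2.
pose s1 := [seq (i, j) | i <- tri N, j <- tri N].
pose s2 := [seq p | M <- tri N, p <- splits M].
transitivity (\sum_(p <- s1) G p); first by rewrite big_allpairs_dep.
transitivity (\sum_(p <- s2) G p); last by rewrite big_allpairs_dep.
rewrite (bigID (fun p => wt p.1 + wt p.2 <= N)%N) /= [X in _ + X]big1 ?addr0.
  rewrite -big_filter; apply/perm_big/uniq_perm.
  - apply/filter_uniq/allpairs_uniq; rewrite ?tri_uniq //.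
    by move=> [I J] [I' J'] _ _ /= [-> ->].
  - apply: allpairs_uniq_dep => [|M _|]; [exact: tri_uniq|exact: splits_uniq|].
    (* The blocks [splits M] are disjoint: a pair determines [M] as the sum of its components. *)
    move=> [M p] [M' p'] /allpairsPdep[x [y [_ + [-> ->]]]].
    move=> + /allpairsPdep[x' [y' [_ + [-> ->]]]] /= e.
    by rewrite e !mem_splits => /eqP <- /eqP <-.
  move=> p; rewrite mem_filter.
  apply/andP/allpairsPdep => [[le _]|[M [p' [+ + ->]]]].
    exists (iadd p.1 p.2), p; split=> //; first by rewrite mem_tri wtD.
    by rewrite mem_splits.
  rewrite mem_tri mem_splits => le /eqP eM; move: le; rewrite -eM wtD => le.
  split=> //; apply/allpairsP; exists p'; rewrite !mem_tri /=.
  rewrite (leq_trans (leq_addr _ _) le) (leq_trans (leq_addl _ _) le).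
  by case: p' {le eM}.
by move=> [I J]; rewrite -ltnNge => /F0.
Qed.

Lemma nonzero_split J : J != (0, 0)%N ->
  exists E J', [/\ J = iadd E J', E \in [:: (1, 0); (0, 1)]%N & wt J = (wt J').+1].
Proof.
case: J => [[|k] [|l]] // _.
- by exists (0, 1)%N, (0, l)%N.
- by exists (1, 0)%N, (k, 0)%N.
- by exists (1, 0)%N, (k, l.+1)%N.
Qed.

End Indices.

Section Comeasure.
Context (K : fieldType).
Local Notation idx := (nat * nat)%type.

(* The relations making e_J |-> sum_I e_I (x) u I J an algebra map for the
   product e_I e_J = c I J e_(I + J), and preserving 1 and the augmentation. *)
Definition comeas (c : idx -> idx -> K) (B : algebra K) (u : idx -> idx -> B) :
    Prop :=
  [/\ u (0, 0)%N (0, 0)%N = 1,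
      forall J, J != (0, 0)%N -> u (0, 0)%N J = 0,
      forall I, I != (0, 0)%N -> u I (0, 0)%N = 0 &
      forall M I J, \sum_(p <- splits M) c p.1 p.2 *: (u p.1 I * u p.2 J) =
        c I J *: u M (iadd I J)].

Lemma comeas_morph c (B B' : algebra K) (f : B -> B') u :
  alg_morphism f -> comeas c u -> comeas c (fun I J => f (u I J)).
Proof.
move=> hf [u1 ul ur uM]; split=> [|J /ul ->|I /ur ->|M I J].
- by rewrite u1 (morph1 hf).
- exact: morph0 hf.
- exact: morph0 hf.
rewrite -(morphZ hf) -uM (morph_sum hf); apply: eq_bigr => p _.
by rewrite (morphZ hf) (morphM hf).
Qed.

Lemma eq_comeas c (B : algebra K) (u v : idx -> idx -> B) :
  (forall I J, u I J = v I J) -> comeas c u -> comeas c v.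
Proof. by move=> e; have -> // : u = v by do 2![apply/funext => ?]. Qed.

(** The images of [x] and [y] have no component in degree 0, so a product of [n] of them starts in
    degree [n]. In the induction, a generator is split off [J]: either its entry lies in row 0 and
    vanishes, or the remaining row index has weight smaller than the remaining column index. *)
Lemma comeas_wt c (B : algebra K) (u : idx -> idx -> B) :
    (forall I J, c I J != 0) -> comeas c u ->
  forall I J, (wt I < wt J)%N -> u I J = 0.
Proof.
move=> c0 [_ ul _ uM] I J; have [n] := ubnP (wt J).
elim: n I J => // n ih I J lt_n lt_IJ.
have /nonzero_split[E [J' [eJ Eu wJ]]] : J != (0, 0)%N.
  by rewrite -wt_eq0; case: (wt J) lt_IJ.
have E0 : E != (0, 0)%N by move: Eu; rewrite !inE => /orP[]/eqP->.
have := uM I E J'; rewrite -eJ big_seq big1 => [/esym/eqP|[A A']].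
  by rewrite scaler_eq0 (negPf (c0 _ _)) => /eqP.
rewrite mem_splits /= => /eqP eI; have [A0|A0] := eqVneq A (0, 0)%N.
  by rewrite A0 ul // mul0r scaler0.
rewrite (ih A') ?mulr0 ?scaler0 //; first by rewrite -ltnS -wJ (leq_trans _ lt_n).
rewrite wJ -eI wtD ltnS in lt_IJ; apply: leq_trans lt_IJ.
by rewrite -[X in (X < _)%N]add0n ltn_add2r lt0n wt_eq0.
Qed.

(** Up to a nonzero scalar, every [e_J] with [J] nonzero is a generator times a basis element of
    lower degree, so the columns of [x] and [y] fix an algebra map. *)
Lemma comeas_eq c (B : algebra K) (u v : idx -> idx -> B) :
    (forall I J, c I J != 0) -> comeas c u -> comeas c v ->
    (forall I E, E \in [:: (1, 0); (0, 1)]%N -> u I E = v I E) ->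
  forall I J, u I J = v I J.
Proof.
move=> c0 [u1 ul ur uM] [v1 vl vr vM] eE I J.
have [n] := ubnP (wt J); elim: n I J => // n ih I J lt.
have [->|J0] := eqVneq J (0, 0)%N.
  by have [->|I0] := eqVneq I (0, 0)%N; rewrite ?u1 ?v1 // ur ?vr.
have [E [J' [eJ Eu wJ]]] := nonzero_split J0.
apply: (scalerI (c0 E J')); rewrite eJ -uM -vM; apply: eq_bigr => p _.
by rewrite eE // (ih p.2) // -ltnS -wJ.
Qed.

(** The corresponding algebra map is the identity [e_J |-> e_J]. *)
Lemma comeas_counit c : comeas c (fun I J => (I == J)%:R : base_alg K).
Proof.
split=> [|J /negPf J0|I /negPf I0|M I J].
- by rewrite eqxx.
- by rewrite eq_sym J0.
- by rewrite I0.
rewrite (bigID (pred1 (I, J))) /= [X in _ + X]big1 ?addr0; last first.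
  move=> [A A'] /=; rewrite xpair_eqE; case: eqP => /= _; last first.
    by rewrite mul0r scaler0.
  by move/negPf=> ->; rewrite mulr0 scaler0.
rewrite -big_filter; case mM: ((I, J) \in splits M).
  rewrite filter_pred1_uniq ?splits_uniq // big_seq1 /= !eqxx mulr1.
  by move: mM; rewrite mem_splits eq_sym => ->.
rewrite (@eq_in_filter _ _ pred0) ?filter_pred0 ?big_nil.
  by move: mM; rewrite mem_splits eq_sym => ->; rewrite scaler0.
by move=> p pM /=; apply/eqP => ep; rewrite -ep pM in mM.
Qed.

(** The composite of two coactions is again an algebra map. The pairing [P] is kept abstract so as
    to cover the tensor product and also its flip, which appears when the families are
    transposed. *)
Lemma comeas_mul c (A B C : algebra K) (P : A -> B -> C) u v :
    bilin P -> P 1 1 = 1 ->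
    (forall a a' b b', P (a * a') (b * b') = P a b * P a' b') ->
    (forall I J, (wt I < wt J)%N -> u I J = 0) ->
    comeas c u -> comeas c v ->
  comeas c (fun I J => \sum_(L <- tri (wt I)) P (u I L) (v L J)).
Proof.
move=> Pb P1 PM u0 [u1 ul ur uM] [v1 vl vr vM].
have PDl b x y : P (x + y) b = P x b + P y b.
  by have := Pb.1 b 1 x y; rewrite !scale1r.
have PDr a x y : P a (x + y) = P a x + P a y.
  by have := Pb.2 a 1 x y; rewrite !scale1r.
have P0l b : P 0 b = 0 by apply: (addrI (P 0 b)); rewrite -PDl !addr0.
have P0r a : P a 0 = 0 by apply: (addrI (P a 0)); rewrite -PDr !addr0.
have PZl k a b : P (k *: a) b = k *: P a b.
  by have := Pb.1 b k a 0; rewrite P0l !addr0.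
have PZr k a b : P a (k *: b) = k *: P a b.
  by have := Pb.2 a k b 0; rewrite P0r !addr0.
have Psl (I : Type) (r : seq I) E b :
    P (\sum_(i <- r) E i) b = \sum_(i <- r) P (E i) b.
  exact: (big_morph (P^~ b) (PDl b) (P0l b)).
have Psr (I : Type) (r : seq I) E a :
    P a (\sum_(i <- r) E i) = \sum_(i <- r) P a (E i).
  exact: (big_morph (P a) (PDr a) (P0r a)).
split=> [|J J0|I I0|M I J].
- by rewrite /tri /= big_seq1 u1 v1.
- by rewrite /tri /= big_seq1 vl.
- rewrite big1 // => L _; have [->|/vr ->] := eqVneq L (0, 0)%N; last by [].
  by rewrite ur.
(* The range of summation depends on the row; all rows dividing [M] are brought to the common range
   [tri (wt M)], so that the sums can be exchanged. *)
have wide I' J' : (wt I' <= wt M)%N ->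
    \sum_(L <- tri (wt I')) P (u I' L) (v L J') =
    \sum_(L <- tri (wt M)) P (u I' L) (v L J').
  by move=> le; apply/esym/sum_tri_widen => // L /u0 ->.
transitivity (\sum_(L <- tri (wt M)) \sum_(L' <- tri (wt M))
    P (u M (iadd L L')) (c L L' *: (v L I * v L' J))).
  transitivity (\sum_(p <- splits M) \sum_(L <- tri (wt M)) \sum_(L' <- tri (wt M))
      c p.1 p.2 *: (P (u p.1 L) (v L I) * P (u p.2 L') (v L' J))).
    rewrite big_seq [RHS]big_seq; apply: eq_bigr => p.
    rewrite mem_splits => /eqP eM.
    have le1 : (wt p.1 <= wt M)%N by rewrite -eM wtD leq_addr.
    have le2 : (wt p.2 <= wt M)%N by rewrite -eM wtD leq_addl.
    rewrite (wide _ _ le1) (wide _ _ le2) mulr_suml scaler_sumr.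
    by apply: eq_bigr => L _; rewrite mulr_sumr scaler_sumr.
  rewrite exchange_big; apply: eq_bigr => L _ /=.
  rewrite exchange_big; apply: eq_bigr => L' _ /=.
  rewrite PZr -PZl -uM Psl; apply: eq_bigr => p _.
  by rewrite PZl PM.
rewrite sum_tri_splits => [|L L' lt]; last by rewrite u0 ?P0l // wtD.
rewrite scaler_sumr; apply: eq_bigr => Q _; rewrite -PZr -vM Psr.
rewrite big_seq [RHS]big_seq.
by apply: eq_bigr => p; rewrite mem_splits => /eqP ->.
Qed.

End Comeasure.

(** * The bialgebras M_0 and M_0(Delta_+) *)

Lemma quota_rel0 (K : fieldType) (A : algebra K) (S : A -> Prop) s :
  S s -> quota_pi (genideal S) s = 0.
Proof.
move=> hs; rewrite -(morph0 (@quota_pi_morphism _ _ (genideal S))).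
by apply/quota_piP; rewrite subr0 => J; apply.
Qed.

Section ComeasuringBialgebras.
Context (K : fieldType) (q : K).
Local Notation idx := (nat * nat)%type.
Local Notation t I J := (freegen K (I : idx, J : idx)).

(** [mu] holds the structure constants of the plane, [e_I e_J = mu I J e_(I+J)]. [nu I J] is the
    coefficient of [e_I (x) e_J] in the coaddition of [e_(I+J)], that is, a structure constant of
    the dual algebra. *)
Definition mu (I J : idx) : K := q ^+ (I.2 * J.1).
Definition nu (I J : idx) : K :=
  qbinom (q ^+ 2) (I.1 + J.1) I.1 * qbinom (q ^+ 2) (I.2 + J.2) I.2 * mu I J.

Section Relations.
Context (B : algebra K) (u : idx -> idx -> B).

Lemma M0_rel_mulE (F : freealg K (idx * idx)%type -> B) m n i j k l :
    alg_morphism F -> (forall I J, F (t I J) = u I J) ->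
  F (\sum_(a < m.+1) \sum_(b < n.+1)
        q ^+ (b * (m - a)) *: (t (a : nat, b : nat) (i, j) *
                               t ((m - a)%N, (n - b)%N) (k, l))
     - q ^+ (j * k) *: t (m, n) ((i + k)%N, (j + l)%N)) =
  \sum_(p <- splits (m, n)) mu p.1 p.2 *: (u p.1 (i, j) * u p.2 (k, l))
  - mu (i, j) (k, l) *: u (m, n) (iadd (i, j) (k, l)).
Proof.
move=> hF Fu; rewrite (morphB hF) (morphZ hF) Fu (morph_sum hF); congr (_ - _).
rewrite (sum_splits (m, n) (fun A A' => mu A A' *: (u A (i, j) * u A' (k, l)))).
apply: eq_bigr => a _; rewrite (morph_sum hF); apply: eq_bigr => b _.
by rewrite (morphZ hF) (morphM hF) !Fu.
Qed.

Lemma M0D_relE (F : M0 q -> B) M I I' :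
    alg_morphism F -> (forall I J, F (M0_t q I J) = u I J) ->
  F (\sum_(A \in [set: idx]) coadd_coef q A I I' *: M0_t q A M
     - \sum_(AB \in [set: idx * idx])
         coadd_coef q M AB.1 AB.2 *: (M0_t q I AB.1 * M0_t q I' AB.2)) =
  nu I I' *: u (iadd I I') M
  - \sum_(p <- splits M) nu p.1 p.2 *: (u I p.1 * u I' p.2).
Proof.
case: M I I' => [m n] [i j] [k l] hF Fu.
rewrite coadd_rel_lhs coadd_rel_rhs (morphB hF) (morphZ hF) Fu; congr (_ - _).
rewrite (sum_splits (m, n) (fun A A' => nu A A' *: (u (i, j) A * u (k, l) A'))).
rewrite (morph_sum hF); apply: eq_bigr => a _.
rewrite (morph_sum hF); apply: eq_bigr => b _.
by rewrite (morphZ hF) (morphM hF) !Fu /nu /= !subnKC ?leq_ord.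
Qed.

Lemma M0_lift : comeas mu u ->
  exists F : M0 q -> B, alg_morphism F /\ forall I J, F (M0_t q I J) = u I J.
Proof.
move=> [u1 ul ur uM].
have [F [hF Fu]] := freealg_lift (fun p : idx * idx => u p.1 p.2).
have [|G [hG GF]] := @quota_lift _ _ _ (M0_rel q) F hF.
  move=> s [m n i j k l||J J0|I I0].
  - by rewrite (M0_rel_mulE _ _ _ _ _ _ hF (fun I J => Fu (I, J))) uM subrr.
  - by rewrite (morphB hF) Fu (morph1 hF) u1 subrr.
  - by rewrite Fu ul.
  - by rewrite Fu ur.
by exists G; split=> // I J; rewrite GF Fu.
Qed.

Lemma M0D_lift : comeas mu u -> comeas nu (fun I J => u J I) ->
  exists F : M0D q -> B, alg_morphism F /\ forall I J, F (M0D_t q I J) = u I J.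
Proof.
move=> /M0_lift[F [hF Fu]] [_ _ _ uM].
have [|G [hG GF]] := @quota_lift _ _ _ (@M0D_rel _ q) F hF.
  move=> s [M I I']; rewrite (M0D_relE _ _ _ hF Fu).
  by apply/eqP; rewrite subr_eq0 uM.
by exists G; split=> // I J; rewrite GF Fu.
Qed.

End Relations.

Lemma M0_comeas : comeas mu (M0_t q).
Proof.
pose p := quota_pi (genideal (M0_rel q)).
have hp : alg_morphism p by apply: quota_pi_morphism.
have r0 s : M0_rel q s -> p s = 0 by apply: quota_rel0.
split=> [|J J0|I I0|[m n] [i j] [k l]].
- apply/subr0_eq; rewrite -(morph1 hp) -[M0_t _ _ _]/(p _) -(morphB hp).
  exact/r0/M0_rel_one.
- exact/r0/M0_rel_up.
- exact/r0/M0_rel_low.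
have := r0 _ (M0_rel_mul q m n i j k l).
by rewrite (M0_rel_mulE (u := M0_t q) _ _ _ _ _ _ hp) // => /subr0_eq.
Qed.

Lemma M0_generates : generates (fun p : idx * idx => M0_t q p.1 p.2).
Proof.
move=> B f g hf hg e; apply: (pres_generates hf hg) => -[I J].
exact: (e (I, J)).
Qed.

Lemma M0D_pi_morphism : alg_morphism (@M0D_pi _ q).
Proof. exact: quota_pi_morphism. Qed.

Lemma M0D_comeas : comeas mu (M0D_t q).
Proof. exact: comeas_morph M0D_pi_morphism M0_comeas. Qed.

Lemma M0D_cocomeas : comeas nu (fun I J => M0D_t q J I).
Proof.
have [t1 tl tr _] := M0D_comeas; split=> // M I I'.
apply/esym/subr0_eq.
rewrite -(M0D_relE M I I' M0D_pi_morphism (fun _ _ => erefl)).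
exact/quota_rel0/RespectRel.
Qed.

Lemma M0D_generates : generates (fun p : idx * idx => M0D_t q p.1 p.2).
Proof. exact: quota_generates M0_generates. Qed.

Hypotheses (q_neq0 : q != 0) (q_generic : generic q).

Lemma mu_neq0 I J : mu I J != 0.
Proof. by rewrite expf_neq0. Qed.

Lemma qfact_neq0 n : qfact (q ^+ 2) n != 0.
Proof. by rewrite prodf_seq_neq0; apply/allP => i _ /=; apply: q_generic. Qed.

Lemma nu_neq0 I J : nu I J != 0.
Proof.
by rewrite !mulf_neq0 ?mu_neq0 // ?invr_eq0 ?mulf_neq0 ?qfact_neq0.
Qed.

Lemma M0_wt I J : (wt I < wt J)%N -> M0_t q I J = 0.
Proof. exact: comeas_wt mu_neq0 M0_comeas _ _. Qed.

(** The product relations kill the entries with [wt I < wt J], and the same argument applied to the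
    transposed family kills those with [wt I > wt J]. *)
Lemma M0D_wt I J : wt I != wt J -> M0D_t q I J = 0.
Proof.
rewrite neq_ltn => /orP[]; first exact: comeas_wt mu_neq0 M0D_comeas _ _.
exact: (comeas_wt nu_neq0 M0D_cocomeas).
Qed.

Lemma tri_trans (I J : idx) : J \in tri (wt I) -> {subset tri (wt J) <= tri (wt I)}.
Proof. by rewrite mem_tri => le L; rewrite !mem_tri => /leq_trans; apply. Qed.

Lemma M0_bialgebra_exists : exists D e, M0_bialgebra (q := q) D e.
Proof.
have [D [hD Dt]] := M0_lift (comeas_mul (tensor_bilin _ _) (tensor11 _ _)
  (fun a a' b b' => esym (tensorM a a' b b')) M0_wt M0_comeas M0_comeas).
have [e [he et]] := M0_lift (comeas_counit mu).
exists D, e; split=> //.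
  apply: (matrix_bialgebra M0_generates _ _ tri_trans hD he Dt et) => [I|I L].
    exact: tri_uniq.
  by rewrite mem_tri -ltnNge => /M0_wt.
move=> I J; rewrite Dt (fsbig_seq _ _ (tri_uniq _)).
apply: fsbig_widen => // L [_ /= nL]; rewrite M0_wt ?tensor0l //.
by rewrite ltnNge; apply/negP => le; apply: nL; rewrite mem_tri.
Qed.

Lemma M0D_bialgebra_exists D0 e0 : M0_bialgebra (q := q) D0 e0 ->
  exists D e, [/\ M0D_bialgebra D0 e0 D e,
    forall I J, D (M0D_t q I J) =
      \sum_(L <- tri (wt I)) M0D_t q I L \ox M0D_t q L J &
    forall I J, e (M0D_t q I J) = (I == J)%:R].
Proof.
move=> [[hD0 he0 _ _ _] D0t e0t].
have tr I J : (wt I < wt J)%N -> M0D_t q I J = 0.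
  by move=> lt; rewrite M0D_wt // ltn_eqF.
have hc : comeas mu (fun I J => \sum_(L <- tri (wt I)) M0D_t q I L \ox M0D_t q L J).
  apply: comeas_mul tr M0D_comeas M0D_comeas.
  - exact: tensor_bilin.
  - exact: tensor11.
  - by move=> a a' b b'; rewrite tensorM.
have hc' : comeas nu
    (fun J I => \sum_(L <- tri (wt I)) M0D_t q I L \ox M0D_t q L J).
  (* The transpose of a matrix product is the product of the transposes in reverse order, whence the
     flipped tensor product. *)
  have bil : bilin (fun u v : M0D q => v \ox u).
    split=> [b|a] k x y; first by rewrite tensorDr tensorZr.
    by rewrite tensorDl tensorZl.
  have trT I J : (wt I < wt J)%N -> M0D_t q J I = 0.
    by move=> lt; rewrite M0D_wt // gtn_eqF.
  apply: eq_comeas (comeas_mul bil _ _ trT M0D_cocomeas M0D_cocomeas).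
  (* The two sums range over [tri (wt I)] and [tri (wt J)]. For equal weights the ranges coincide;
     otherwise no [L] has the weight of both [I] and [J], and every term vanishes. *)
  - move=> I J; have [eIJ|nIJ] := eqVneq (wt I) (wt J); first by rewrite eIJ.
    rewrite !big1 // => L _; have [eIL|nIL] := eqVneq (wt I) (wt L).
    + by rewrite (@M0D_wt J L) ?tensor0l // -eIL eq_sym.
    + by rewrite (@M0D_wt L I) ?tensor0r // eq_sym.
    + by rewrite (@M0D_wt J L) ?tensor0l // -eIL eq_sym.
    + by rewrite (@M0D_wt L I) ?tensor0r // eq_sym.
  - exact: tensor11.
  - by move=> a a' b b'; rewrite tensorM.
have [D [hD Dt]] := M0D_lift hc hc'.
have hn : comeas nu (fun J I : idx => (I == J)%:R : base_alg K).
  by apply: eq_comeas (comeas_counit nu) => I J; rewrite eq_sym.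
have [e [he et]] := M0D_lift (comeas_counit mu) hn.
have hpi := M0D_pi_morphism.
exists D, e; split=> //; split.
  apply: (matrix_bialgebra M0D_generates _ _ tri_trans hD he Dt et) => [I|I L].
    exact: tri_uniq.
  by rewrite mem_tri -ltnNge => /tr.
split=> //.
  have hpp := tens_map_morphism hpi hpi.
  apply: (M0_generates (morph_comp hpi hD) (morph_comp hD0 hpp)) => -[I J] /=.
  rewrite Dt D0t -(fsbig_widen [set` tri (wt I)]) // => [|L [_ /= nL]].
    rewrite -(fsbig_seq _ _ (tri_uniq _)) (morph_sum hpp).
    by apply: eq_bigr => L _; rewrite (tens_mapE hpi hpi).
  rewrite M0_wt ?tensor0l //.
  by rewrite ltnNge; apply/negP => le; apply: nL; rewrite mem_tri.
have he0' : alg_morphism (e0 : M0 q -> base_alg K) by [].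
apply: (M0_generates (morph_comp hpi he) he0') => -[I J] /=.
by rewrite et e0t.
Qed.

End ComeasuringBialgebras.

(** * The coaction of quantum matrices on the plane *)

Section QuantumMatrixCoaction.
Context (K : fieldType) (q : K) (B : algebra K).
Local Notation idx := (nat * nat)%type.

(** The last equation is the [x y] coefficient of [Y X = q X Y] for [X = x a + y c] and
    [Y = x b + y d]. Given [b c = c b] and [q != 0], it amounts to the relation for [a d - d a]
    ([Mq_commutator]). *)
Definition Mq_rel (a b c d : B) : Prop :=
  [/\ b * a = q *: (a * b), c * a = q *: (a * c), d * c = q *: (c * d),
      d * b = q *: (b * d) &
      b * c = c * b /\ b * c + q *: (d * a) = q *: (a * d) + q ^+ 2 *: (c * b)].

Lemma Mq_rel_swap a b c d : Mq_rel a b c d -> Mq_rel a c b d.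
Proof. by case=> h1 h2 h3 h4 [h5 h6]; split=> //; split; rewrite // -h5 h6 h5. Qed.

(* Left multiplication by x (x) u + y (x) v on the plane with coefficients
   in B, an element sum_I e_I (x) f I of which is represented by f. *)
Definition step (u v : B) (f : idx -> B) (I : idx) : B :=
  (if I.1 is i.+1 then u * f (i, I.2) else 0) +
  (if I.2 is j.+1 then q ^+ I.1 *: (v * f (I.1, j)) else 0).

Definition unit0 (I : idx) : B := (I == (0, 0)%N)%:R.

(** The coefficient of [e_I] in [(x a + y c)^k (x b + y d)^l], where [J = (k, l)]. *)
Definition coact (a b c d : B) (I J : idx) : B :=
  iter J.1 (step a c) (iter J.2 (step b d) unit0) I.

Definition pmul (f g : idx -> B) (M : idx) : B :=
  \sum_(p <- splits M) mu q p.1 p.2 *: (f p.1 * g p.2).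

Lemma pmulE f g m n : pmul f g (m, n) =
  \sum_(a < m.+1) \sum_(b < n.+1)
    q ^+ (b * (m - a)) *: (f (a : nat, b : nat) * g ((m - a)%N, (n - b)%N)).
Proof. exact: (sum_splits (m, n) (fun A A' => mu q A A' *: (f A * g A'))). Qed.

Lemma pmul_unit0 g : pmul unit0 g = g.
Proof.
apply/funext => -[m n]; rewrite pmulE big_ord_recl [X in _ + X]big1 ?addr0.
  rewrite big_ord_recl [X in _ + X]big1 ?addr0 => [|b _].
    by rewrite /unit0 /= scale1r mul1r !subn0.
  by rewrite /unit0 xpair_eqE /= ?andbF mul0r scaler0.
move=> a _; rewrite big1 // => b _.
by rewrite /unit0 xpair_eqE /= mul0r scaler0.
Qed.

(** Associativity of the product when the left factor has degree one; iterating it handles products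
    of powers. *)
Lemma pmul_step u v f g : pmul (step u v f) g = step u v (pmul f g).
Proof.
apply/funext => -[m n]; rewrite pmulE.
transitivity
  (\sum_(a < m.+1) \sum_(b < n.+1) q ^+ (b * (m - a)) *:
     ((if a : nat is i.+1 then u * f (i, b : nat) else 0) *
      g ((m - a)%N, (n - b)%N)) +
   \sum_(a < m.+1) \sum_(b < n.+1) q ^+ (b * (m - a)) *:
     ((if b : nat is j.+1 then q ^+ a *: (v * f (a : nat, j)) else 0) *
      g ((m - a)%N, (n - b)%N))).
  rewrite -big_split; apply: eq_bigr => a _; rewrite -big_split.
  by apply: eq_bigr => b _; rewrite /step /= mulrDl scalerDr.
congr (_ + _).
  rewrite big_ord_recl big1 => [|b _]; last by rewrite mul0r scaler0.
  case: m => [|m] /=; first by rewrite big_ord0 add0r.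
  rewrite add0r pmulE mulr_sumr; apply: eq_bigr => a _.
  rewrite mulr_sumr; apply: eq_bigr => b _.
  by rewrite -algZAr mulrA.
case: n => [|n] /=.
  by apply: big1 => a _; rewrite big_ord_recl big_ord0 mul0r scaler0 addr0.
rewrite pmulE mulr_sumr scaler_sumr; apply: eq_bigr => a _.
rewrite big_ord_recl mul0r scaler0 add0r mulr_sumr scaler_sumr.
apply: eq_bigr => b _; rewrite -algZAl -!algZAr mulrA !scalerA; congr (_ *: _).
(* Moving [y] past [x^a] and then past [x^(m-a)] costs as much as moving it past [x^m]. *)
rewrite -!exprD; congr (_ ^+ _).
by rewrite mulSn addnAC subnK ?leq_ord.
Qed.

Lemma step_scale u v k f : step u v (k \*: f) = k \*: step u v f.
Proof.
apply/funext => -[[|i] [|j]]; rewrite /step /= ?addr0 ?add0r ?scaler0 //.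
- by rewrite -algZAr scalerA mulrC -scalerA.
- by rewrite -algZAr.
- by rewrite scalerDr -!algZAr scalerA mulrC -scalerA.
Qed.

Context (a b c d : B) (rel : Mq_rel a b c d).

(** This is [Y X = q X Y] for [X = x a + y c], [Y = x b + y d]. The coefficients of [x^2], [y^2] and
    [x y] give [eP], [eR] and [mid] respectively. *)
Lemma step_commute f : step b d (step a c f) = q \*: step a c (step b d f).
Proof.
case: rel => ba _ dc _ [_ bcda].
have eP i j : b * (if i is i'.+1 then a * f (i', j) else 0) =
    q *: (a * (if i is i'.+1 then b * f (i', j) else 0)).
  by case: i => [|i]; rewrite ?mulr0 ?scaler0 // !mulrA ba -algZAl.
have eR i j z : d * (if j is j'.+1 then z *: (c * f (i, j')) else 0) =
    q *: (c * (if j is j'.+1 then z *: (d * f (i, j')) else 0)).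
  case: j => [|j]; rewrite ?mulr0 ?scaler0 // -!algZAr !mulrA dc.
  by rewrite -algZAl !scalerA mulrC.
have mid i x : b * (q ^+ i *: (c * x)) + q ^+ i.+1 *: (d * (a * x)) =
    q *: (a * (q ^+ i *: (d * x))) + q *: (q ^+ i.+1 *: (c * (b * x))).
  rewrite -!algZAr !mulrA exprS (mulrC q) -scalerA -scalerDr.
  rewrite (algZAl q (d * a)) -mulrDl bcda.
  rewrite mulrDl -!algZAl scalerDr !scalerA; congr (_ *: _ + _ *: _).
    by ring.
  by ring.
apply/funext => -[[|i] [|j]]; rewrite /step /= ?addr0 ?add0r ?scaler0 //.
- by rewrite !expr0 !scale1r eR.
rewrite !mulrDr !scalerDr eP eR -!addrA; congr (_ + _).
rewrite !addrA mid; congr (_ + _).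
by rewrite !scalerA mulrC.
Qed.

Lemma iter_step_commute l k f :
  iter l (step b d) (iter k (step a c) f) =
  q ^+ (l * k) \*: iter k (step a c) (iter l (step b d) f).
Proof.
have comm1 l' g : iter l' (step b d) (step a c g) =
    q ^+ l' \*: step a c (iter l' (step b d) g).
  elim: l' => [|l' /= ->]; first by apply/funext => I; rewrite /= scale1r.
  rewrite step_scale step_commute; apply/funext => I /=.
  by rewrite scalerA -exprSr.
elim: k => [|k ih] /=; first by apply/funext => I; rewrite /= muln0 scale1r.
rewrite comm1 ih step_scale; apply/funext => I /=.
by rewrite scalerA -exprD mulnS.
Qed.

Lemma coact_comeas : comeas (mu q) (coact a b c d).
Proof.
split=> [|[[|k] [|l]]|I I0|M I J] //.
- by rewrite /coact /step /= addr0.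
- by rewrite /coact /step /= addr0.
- by rewrite /coact /step /= addr0.
- by rewrite /coact /unit0 /= (negPf I0).
rewrite -[LHS]/(pmul (coact a b c d ^~ I) (coact a b c d ^~ J) M).
have pmul_iter u v n f g :
    pmul (iter n (step u v) f) g = iter n (step u v) (pmul f g).
  by elim: n => //= n ih; rewrite pmul_step ih.
rewrite /coact !pmul_iter pmul_unit0 iter_step_commute.
have -> g z : iter I.1 (step a c) (z \*: g) = z \*: iter I.1 (step a c) g.
  by elim: I.1 => //= n ->; rewrite step_scale.
by rewrite /= -!iterD.
Qed.

End QuantumMatrixCoaction.

Section ClosedForm.
Context (K : fieldType) (q : K) (q_neq0 : q != 0) (q_generic : generic q).
Local Notation idx := (nat * nat)%type.
Local Notation "[ n ]_q" := (qint (q ^+ 2) n) (at level 0, format "[ n ]_q").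
Local Notation qf := (qfact (q ^+ 2)).

Definition qfact2 (I : idx) : K := qf I.1 * qf I.2.

Lemma qfactS n : qf n.+1 = qf n * [n.+1]_q.
Proof. by rewrite /qfact big_ord_recr. Qed.

Lemma qintD m n : [m + n]_q = [m]_q + q ^+ (2 * m) * [n]_q.
Proof.
rewrite /qint big_split_ord; congr (_ + _); rewrite mulr_sumr.
by apply: eq_bigr => i _ /=; rewrite exprD exprM.
Qed.

Lemma qfact2_neq0 I : qfact2 I != 0.
Proof. by rewrite mulf_neq0 ?qfact_neq0. Qed.

(* The coefficient of a^r c^p b^s d^t in (x a + y c)^(r+p) (x b + y d)^(s+t),
   divided by [r+p]! [s+t]!. *)
Definition weight (r p s t : nat) : K :=
  q ^+ (p * s) / (qf r * qf p * qf s * qf t).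

(** Here lies the symmetry behind the transposition: exchanging rows and columns exchanges [p] and
    [s]. *)
Lemma weight_swap r p s t : weight r p s t = weight r s p t.
Proof. by rewrite /weight mulnC; congr (_ / _); ring. Qed.

Lemma weightS1 r p s t : [r.+1]_q * weight r.+1 p s t = weight r p s t.
Proof.
rewrite /weight qfactS; field.
by rewrite !qfact_neq0 // q_generic.
Qed.

Lemma weightS2 r p s t : [p.+1]_q * weight r p.+1 s t = q ^+ s * weight r p s t.
Proof.
rewrite /weight qfactS mulSn exprD; field.
by rewrite !qfact_neq0 // q_generic.
Qed.

Lemma weightS3 p s t : [s.+1]_q * weight 0 p s.+1 t = q ^+ p * weight 0 p s t.
Proof. by rewrite !(weight_swap 0 p) weightS2. Qed.

Lemma weightS4 r p s t : [t.+1]_q * weight r p s t.+1 = weight r p s t.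
Proof.
rewrite /weight qfactS; field.
by rewrite !qfact_neq0 // q_generic.
Qed.

Section Monomials.
Context (B : algebra K) (a b c d : B) (rel : Mq_rel q a b c d).

(** The order is that of the product [(x a + y c)^k (x b + y d)^l]. Only [b c = c b] is required to
    exchange the two middle factors. *)
Definition monomial (r p s t : nat) : B := a ^+ r * c ^+ p * b ^+ s * d ^+ t.

Lemma qcomm_exp (u v : B) n : v * u = q *: (u * v) ->
  v * u ^+ n = q ^+ n *: (u ^+ n * v).
Proof.
move=> vu; elim: n => [|n ih]; first by rewrite !expr0 mulr1 mul1r scale1r.
by rewrite !exprS mulrA vu -algZAl -mulrA ih -algZAr scalerA mulrA.
Qed.

Lemma monomialS1 r p s t : a * monomial r p s t = monomial r.+1 p s t.
Proof. by rewrite /monomial !mulrA -exprS. Qed.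

Lemma monomialS2 r p s t : c * monomial r p s t = q ^+ r *: monomial r p.+1 s t.
Proof.
case: rel => _ ca _ _ _.
by rewrite /monomial !mulrA (qcomm_exp _ ca) -!algZAl exprS !mulrA.
Qed.

Lemma monomialS3 s t : b * monomial 0 0 s t = monomial 0 0 s.+1 t.
Proof. by rewrite /monomial !expr0 !mul1r mulrA -exprS. Qed.

Lemma monomialS4 s t : d * monomial 0 0 s t = q ^+ s *: monomial 0 0 s t.+1.
Proof.
case: rel => _ _ _ db _.
by rewrite /monomial !expr0 !mul1r mulrA (qcomm_exp _ db) -!algZAl exprS !mulrA.
Qed.

Definition term (r p s t : nat) : idx -> B := fun I =>
  (weight r p s t *: monomial r p s t) *+ (I == ((r + s)%N, (p + t)%N)).

Lemma step_at (u v m : B) (i j : nat) I :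
  step q u v (fun J => m *+ (J == (i, j))) I =
  (u * m) *+ (I == (i.+1, j)) + (q ^+ i *: (v * m)) *+ (I == (i, j.+1)).
Proof.
case: I => k l; rewrite /step /=; congr (_ + _).
  by case: k => [|k]; rewrite ?mulrnAr !xpair_eqE.
case: l => [|l]; rewrite !xpair_eqE ?andbF // eqSS.
by case: eqP => [->|_] /=; rewrite ?mulr0 ?scaler0 // mulrnAr scalerMnr.
Qed.

Lemma step_sum (u v : B) n (F : 'I_n -> idx -> B) I :
  step q u v (fun J => \sum_(r < n) F r J) I = \sum_(r < n) step q u v (F r) I.
Proof.
rewrite big_split /=; case: I => k l; rewrite /step /=; congr (_ + _).
  by case: k => [|k]; rewrite ?big1_eq // mulr_sumr.
by case: l => [|l]; rewrite ?big1_eq // mulr_sumr scaler_sumr.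
Qed.

Lemma step_term1 r p s t I : step q a c (fun J => term r p s t J) I =
  [r.+1]_q *: term r.+1 p s t I + (q ^+ (2 * r) * [p.+1]_q) *: term r p.+1 s t I.
Proof.
rewrite step_at /term -!scalerMnr !scalerA weightS1 addSn; congr (_ *+ _ + _ *+ _).
  by rewrite -algZAr monomialS1.
rewrite -algZAr monomialS2 !scalerA; congr (_ *: _).
(* The factor [q^(2r)] arises from [y] passing [x^r] and [c] passing [a^r]; the [q^s] from [y]
   passing [x^s] is absorbed by [weightS2]. *)
by rewrite -[RHS]mulrA weightS2 mul2n -addnn !exprD; ring.
Qed.

Lemma step_term2 s t I : step q b d (fun J => term 0 0 s t J) I =
  [s.+1]_q *: term 0 0 s.+1 t I + (q ^+ (2 * s) * [t.+1]_q) *: term 0 0 s t.+1 I.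
Proof.
rewrite step_at /term -!scalerMnr !scalerA weightS3 expr0 mul1r addnS.
congr (_ *+ _ + _ *+ _); first by rewrite -algZAr monomialS3.
rewrite -algZAr monomialS4 !scalerA; congr (_ *: _).
by rewrite -[RHS]mulrA weightS4 mul2n -addnn !exprD; ring.
Qed.

(* q-Pascal: the two terms produced by a step recombine with total weight
   [r] + q^(2r) [n + 1 - r] = [n + 1]. *)
Lemma sum_pascal (V : lmodType K) n (F : nat -> nat -> V) :
  \sum_(r < n.+1) ([r.+1]_q *: F r.+1 (n - r)%N
     + (q ^+ (2 * r) * [(n - r).+1]_q) *: F r (n - r).+1) =
  [n.+1]_q *: \sum_(r < n.+2) F r (n.+1 - r)%N.
Proof.
have q0 : [0]_q = 0 by rewrite /qint big_ord0.
rewrite big_split /= scaler_sumr.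
transitivity (\sum_(r < n.+2) [r]_q *: F r (n.+1 - r)%N +
    \sum_(r < n.+2) (q ^+ (2 * r) * [n.+1 - r]_q) *: F r (n.+1 - r)%N).
  rewrite [X in _ = X + _]big_ord_recl [X in _ = _ + X]big_ord_recr /=.
  rewrite q0 subnn q0 mulr0 !scale0r add0r addr0; congr (_ + _).
  by apply: eq_bigr => r _; rewrite subSn ?leq_ord.
rewrite -big_split; apply: eq_bigr => r _ /=.
by rewrite -scalerDl -qintD subnKC // leq_ord.
Qed.

(** The q-binomial theorem, used for each factor: the inner induction expands [(x b + y d)^l], the
    outer one multiplies by [x a + y c] from the left. *)
Lemma coact_closed k l I : coact q a b c d I (k, l) =
  qfact2 (k, l) *: \sum_(r < k.+1) \sum_(s < l.+1) term r (k - r) s (l - s) I.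
Proof.
rewrite /coact /=; elim: k I => [|k ih] I.
  elim: l I => [|l ih] I /=.
    rewrite !big_ord1 /term /weight /monomial /qfact2 /qfact /= !big_ord0.
    by rewrite !expr0 !mulr1 divr1 !scale1r.
  have -> : iter l (step q b d) (unit0 B) =
      qfact2 (0%N, l) \*: fun J => \sum_(s < l.+1) term 0 0 s (l - s) J.
    by apply/funext => J /=; have := ih J; rewrite /= big_ord1 subnn.
  rewrite step_scale /= step_sum !big_ord1 subnn.
  rewrite (eq_bigr _ (fun (s : 'I_l.+1) _ => step_term2 s (l - s) I)).
  rewrite (sum_pascal l (fun s t => term 0 0 s t I)) scalerA; congr (_ *: _).
  by rewrite /qfact2 /= qfactS mulrA.
rewrite iterS; have -> : iter k (step q a c) (iter l (step q b d) (unit0 B)) =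
    qfact2 (k, l) \*: fun J => \sum_(r < k.+1) \sum_(s < l.+1)
      term r (k - r) s (l - s) J.
  by apply/funext => J; apply: ih.
rewrite step_scale /= step_sum.
have e (r : 'I_k.+1) : step q a c
    (fun J => \sum_(s < l.+1) term r (k - r) s (l - s) J) I =
    [r.+1]_q *: (\sum_(s < l.+1) term r.+1 (k - r) s (l - s) I) +
    (q ^+ (2 * r) * [(k - r).+1]_q) *:
      (\sum_(s < l.+1) term r (k - r).+1 s (l - s) I).
  rewrite step_sum !scaler_sumr -big_split; apply: eq_bigr => s _.
  exact: step_term1.
rewrite (eq_bigr _ (fun r _ => e r)).
rewrite (sum_pascal k (fun r p => \sum_(s < l.+1) term r p s (l - s) I)) scalerA.
by congr (_ *: _); rewrite /qfact2 /= qfactS mulrAC.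
Qed.

(** The exponents form a 2 by 2 table with margins [r + s = I.1], [p + t = I.2], [r + p = J.1],
    [s + t = J.2], so [r] determines the rest. The guard says that a table exists, which keeps the
    truncated subtractions exact. *)
Definition term1 (I J : idx) (r : nat) : B :=
  if [&& r <= I.1, r <= J.1, I.1 <= r + J.2 & wt I == wt J]%N
  then weight r (J.1 - r) (I.1 - r) (r + J.2 - I.1) *:
       monomial r (J.1 - r) (I.1 - r) (r + J.2 - I.1)
  else 0.

(** The bound [N] is free so that the sums for [(I, J)] and [(J, I)] can be compared term by term
    over one range. *)
Lemma coact_single I J N : (J.1 < N)%N ->
  coact q a b c d I J = qfact2 J *: \sum_(r < N) term1 I J r.
Proof.
case: I J => i j [k l] /= ltkN; rewrite coact_closed; congr (_ *: _).
rewrite (big_ord_widen N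
  (fun r : nat => \sum_(s < l.+1) term r (k - r) s (l - s) (i, j))) //.
rewrite big_mkcond; apply: eq_bigr => r _; rewrite /term1 /wt ltnS /=.
case: (leqP r k) => [rk|_]; last by rewrite andbF.
case: (leqP r i) => [ri|lt] /=; last first.
  rewrite big1 // => s _; rewrite /term xpair_eqE.
  by rewrite (ltn_eqF (leq_trans lt (leq_addr _ _))) mulr0n.
case: ifP => [/andP[le /eqP e]|/negbT ne].
  have ls : (i - r < l.+1)%N by rewrite ltnS leq_subLR.
  rewrite (bigD1 (Ordinal ls)) //= [X in _ + X]big1 ?addr0 => [|s ns].
    rewrite /term xpair_eqE subnKC // eqxx subnBA // (addnC l).
    case: eqP => // -[]; lia.
  rewrite /term xpair_eqE; case: eqP => [e1|_]; last by rewrite mulr0n.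
  by case/eqP: ns; apply/val_inj; rewrite /= e1 addKn.
rewrite big1 // => s _; rewrite /term xpair_eqE.
case: andP => [[/eqP e1 /eqP e2]|_]; last by rewrite mulr0n.
case/negP: ne; have := ltn_ord s; rewrite ltnS e1 e2 => sl.
rewrite leq_add2l sl; apply/eqP; lia.
Qed.

End Monomials.

Lemma term1_swap (B : algebra K) (a b c d : B) I J r : b * c = c * b ->
  term1 a b c d I J r = term1 a c b d J I r.
Proof.
move=> bc; rewrite /term1; case: I J => i j [k l] /=.
have [ri|_] /= := leqP r i; last by rewrite andbF.
have [rk|//] /= := leqP r k.
rewrite [wt (k, l) == _]eq_sym /wt /=.
case: eqP => [e|_]; last by rewrite !andbF.
have -> : (k <= r + j)%N = (i <= r + l)%N by lia.
case: ifP => //= /andP[le _].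
have -> : (r + j - k = r + l - i)%N by lia.
rewrite weight_swap; congr (_ *: _); rewrite /monomial.
have cX : GRing.comm (b ^+ (i - r)) (c ^+ (k - r)).
  exact/commrX/commr_sym/commrX/commr_sym.
by rewrite -(mulrA (a ^+ r)) -cX mulrA.
Qed.

Lemma coact_transpose (B : algebra K) (a b c d : B) I J : Mq_rel q a b c d ->
  qfact2 I *: coact q a b c d I J = qfact2 J *: coact q a c b d J I.
Proof.
move=> rel; have bc : b * c = c * b by case: rel => _ _ _ _ [].
have lt1 : (J.1 < (I.1 + J.1).+1)%N by rewrite ltnS leq_addl.
have lt2 : (I.1 < (I.1 + J.1).+1)%N by rewrite ltnS leq_addr.
rewrite (coact_single rel I lt1) (coact_single (Mq_rel_swap rel) J lt2).
rewrite !scalerA mulrC; congr (_ *: _); apply: eq_bigr => r _.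
exact: term1_swap.
Qed.

(** In the dual algebra, the rescaled basis [[I]! e_I] therefore multiplies with the constants [mu]
    of the plane. *)
Lemma nuE I J : nu q I J = mu q I J * qfact2 (iadd I J) / (qfact2 I * qfact2 J).
Proof.
rewrite /nu /qbinom /qfact2 /= !addKn; field.
by rewrite !qfact_neq0.
Qed.

Lemma coact_cocomeas (B : algebra K) (a b c d : B) : Mq_rel q a b c d ->
  comeas (nu q) (fun I J => coact q a b c d J I).
Proof.
move=> rel.
have e I J : coact q a b c d J I = (qfact2 I / qfact2 J) *: coact q a c b d I J.
  rewrite mulrC -scalerA -(coact_transpose J I rel) scalerA mulVf ?scale1r //.
  exact: qfact2_neq0.
have [T1 Tl Tr TM] := coact_comeas (Mq_rel_swap rel).
split=> [|J J0|I I0|M I J].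
- by rewrite e T1 divff ?scale1r ?qfact2_neq0.
- by rewrite e Tl ?scaler0.
- by rewrite e Tr ?scaler0.
rewrite !e.
transitivity ((qfact2 M / (qfact2 I * qfact2 J)) *:
    (mu q I J *: coact q a c b d M (iadd I J))).
  rewrite -TM scaler_sumr big_seq [RHS]big_seq; apply: eq_bigr => p.
  rewrite mem_splits => /eqP eM; rewrite !e -algZAl -algZAr !scalerA; congr (_ *: _).
  rewrite nuE eM; field.
  by rewrite !qfact2_neq0.
rewrite !scalerA; congr (_ *: _); rewrite nuE; field.
by rewrite !qfact2_neq0.
Qed.

End ClosedForm.

(** * Identification with the quantum matrices *)

(* Over abstract algebras, so that generators of a free algebra are never
   compared with products. *)
Section QuadraticImages.
Context (K : fieldType) (A B : algebra K) (f : A -> B) (hf : alg_morphism f).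

Lemma morph_qcomm (k : K) (u v u' v' : A) :
  f (u * v - k *: (u' * v')) = f u * f v - k *: (f u' * f v').
Proof. by rewrite (morphB hf) (morphZ hf) !(morphM hf). Qed.

Lemma morph_comm (u v u' v' : A) :
  f (u * v - u' * v') = f u * f v - f u' * f v'.
Proof. by rewrite (morphB hf) !(morphM hf). Qed.

Lemma morph_comm_qcomm (k : K) (u v u' v' u'' v'' : A) :
  f (u * v - u' * v' - k *: (u'' * v'')) =
  f u * f v - f u' * f v' - k *: (f u'' * f v'').
Proof. by rewrite !(morphB hf) (morphZ hf) !(morphM hf). Qed.

End QuadraticImages.

Section QuantumMatrices.
Context (K : fieldType) (q : K) (q_neq0 : q != 0) (q_generic : generic q).
Local Notation idx := (nat * nat)%type.

Lemma Mq_commutator (B : algebra K) (a b c d : B) : b * c = c * b ->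
  a * d - d * a = (q^-1 - q) *: (b * c) <->
  b * c + q *: (d * a) = q *: (a * d) + q ^+ 2 *: (c * b).
Proof.
move=> bc; rewrite -bc; split=> [e|e].
  rewrite -(subrK (d * a) (a * d)) e scalerDr scalerA mulrBr mulfV // -expr2.
  by rewrite scalerBl scale1r addrAC subrK.
apply: (scalerI q_neq0); rewrite scalerBr scalerA mulrBr mulfV //.
rewrite -expr2 scalerBl scale1r.
by apply/eqP; rewrite subr_eq addrAC e addrK.
Qed.

Lemma Mq2_lift (B : algebra K) (a b c d : B) : Mq_rel q a b c d ->
  exists F : Mq2 q -> B, alg_morphism F /\
    [/\ F (Mq2_u q 0 0) = a, F (Mq2_u q 0 1) = b,
        F (Mq2_u q 1 0) = c & F (Mq2_u q 1 1) = d].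
Proof.
move=> [ba ca dc db [bc bcda]].
pose x (p : 'I_2 * 'I_2) :=
  if p.1 == 0 then (if p.2 == 0 then a else b) else (if p.2 == 0 then c else d).
have [F [hF Fx]] := freealg_lift x.
have [|G [hG GF]] := @quota_lift _ _ _ (Mq2_rel q) F hF.
  have [Fa Fb Fc Fd] := And4 (Fx (0, 0)) (Fx (0, 1)) (Fx (1, 0)) (Fx (1, 1)).
  move=> s [].
  - by rewrite (morph_qcomm hF) Fa Fb /x /= ba subrr.
  - by rewrite (morph_qcomm hF) Fa Fc /x /= ca subrr.
  - by rewrite (morph_qcomm hF) Fc Fd /x /= dc subrr.
  - by rewrite (morph_qcomm hF) Fb Fd /x /= db subrr.
  - by rewrite (morph_comm hF) Fb Fc /x /= bc subrr.
  - rewrite (morph_comm_qcomm hF) Fa Fb Fc Fd /x /=.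
    by have /(Mq_commutator _ _ bc) -> := bcda; rewrite subrr.
exists G; split; first exact: hG.
by split; rewrite GF Fx.
Qed.

Lemma Mq2_Mq_rel :
  Mq_rel q (Mq2_u q 0 0) (Mq2_u q 0 1) (Mq2_u q 1 0) (Mq2_u q 1 1).
Proof.
pose p := quota_pi (genideal (Mq2_rel q)).
have hp : alg_morphism p by apply: quota_pi_morphism.
have r0 s : Mq2_rel q s -> p s = 0 by apply: quota_rel0.
have := (r0 _ (Mq2_ba q)); rewrite (morph_qcomm hp) => /subr0_eq ba.
have := (r0 _ (Mq2_ca q)); rewrite (morph_qcomm hp) => /subr0_eq ca.
have := (r0 _ (Mq2_dc q)); rewrite (morph_qcomm hp) => /subr0_eq dc.
have := (r0 _ (Mq2_db q)); rewrite (morph_qcomm hp) => /subr0_eq db.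
have := (r0 _ (Mq2_bc q)); rewrite (morph_comm hp) => /subr0_eq bc.
have := (r0 _ (Mq2_ad q)); rewrite (morph_comm_qcomm hp) => /subr0_eq ad.
split; [exact: ba|exact: ca|exact: dc|exact: db|split; first exact: bc].
by apply/(Mq_commutator _ _ bc); exact: ad.
Qed.

Lemma Mq2_generates : generates (fun p : 'I_2 * 'I_2 => Mq2_u q p.1 p.2).
Proof.
move=> B f g hf hg e; apply: (pres_generates hf hg) => -[i j].
exact: (e (i, j)).
Qed.

(** Rows [(2,0)], [(0,2)] and [(1,1)] of the product relations. The constants [c] are general so
    that the lemma serves for [mu] and, transposed, for [nu], where [c (1,0) (1,0)] is 1 and
    [1 + q^2] respectively. *)
Lemma quadratic_rel (c : idx -> idx -> K) (B : algebra K) (u : idx -> idx -> B) :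
    comeas c u ->
    c (1, 0)%N (1, 0)%N != 0 -> c (0, 1)%N (0, 1)%N != 0 ->
    c (1, 0)%N (0, 1)%N = 1 -> c (0, 1)%N (1, 0)%N = q ->
  let x := u (1, 0)%N (1, 0)%N in let y := u (1, 0)%N (0, 1)%N in
  let z := u (0, 1)%N (1, 0)%N in let w := u (0, 1)%N (0, 1)%N in
  [/\ y * x = q *: (x * y), w * z = q *: (z * w) &
      y * z + q *: (w * x) = q *: (x * w) + q ^+ 2 *: (z * y)].
Proof.
move=> [u1 ul ur uM] c11 c22 c12 c21 x y z w.
have u0 J : J \in [:: (1, 0); (0, 1)]%N -> u (0, 0)%N J = 0.
  by rewrite !inE => /orP[]/eqP-> ; apply: ul.
have M20 I J : I \in [:: (1, 0); (0, 1)]%N -> J \in [:: (1, 0); (0, 1)]%N ->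
    c (1, 0)%N (1, 0)%N *: (u (1, 0)%N I * u (1, 0)%N J) =
    c I J *: u (2, 0)%N (iadd I J).
  move=> hI hJ; rewrite -uM /splits /= !big_cons big_nil /=.
  by rewrite (u0 _ hI) (u0 _ hJ) !(mul0r, mulr0, scaler0, addr0, add0r).
have M02 I J : I \in [:: (1, 0); (0, 1)]%N -> J \in [:: (1, 0); (0, 1)]%N ->
    c (0, 1)%N (0, 1)%N *: (u (0, 1)%N I * u (0, 1)%N J) =
    c I J *: u (0, 2)%N (iadd I J).
  move=> hI hJ; rewrite -uM /splits /= !big_cons big_nil /=.
  by rewrite (u0 _ hI) (u0 _ hJ) !(mul0r, mulr0, scaler0, addr0, add0r).
have M11 I J : I \in [:: (1, 0); (0, 1)]%N -> J \in [:: (1, 0); (0, 1)]%N ->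
    q *: (u (0, 1)%N I * u (1, 0)%N J) + u (1, 0)%N I * u (0, 1)%N J =
    c I J *: u (1, 1)%N (iadd I J).
  move=> hI hJ; rewrite -uM /splits /= !big_cons big_nil /= c12 c21 scale1r.
  by rewrite (u0 _ hI) (u0 _ hJ) !(mul0r, mulr0, scaler0, addr0, add0r).
split.
- apply: (scalerI c11); rewrite M20 // scalerA mulrC -scalerA M20 //.
  by rewrite c12 c21 scale1r.
- apply: (scalerI c22); rewrite M02 // scalerA mulrC -scalerA M02 //.
  by rewrite c12 c21 scale1r.
have := M11 (0, 1)%N (1, 0)%N isT isT; have := M11 (1, 0)%N (0, 1)%N isT isT.
rewrite c12 c21 scale1r -/x -/y -/z -/w => <-; rewrite addrC => ->.
by rewrite scalerDr scalerA addrC.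
Qed.

(* Equating the two expressions of q (a d - d a) gives
   (1 + q^2) (b c - c b) = 0. *)
Lemma Mq_rel_quadratic (B : algebra K) (a b c d : B) :
    b * a = q *: (a * b) -> c * a = q *: (a * c) ->
    d * c = q *: (c * d) -> d * b = q *: (b * d) ->
    b * c + q *: (d * a) = q *: (a * d) + q ^+ 2 *: (c * b) ->
    c * b + q *: (d * a) = q *: (a * d) + q ^+ 2 *: (b * c) ->
  Mq_rel q a b c d.
Proof.
move=> ba ca dc db m1 m2; split=> //; split=> //.
have q2 : 1 + q ^+ 2 != 0.
  by have := @q_generic 2 isT; rewrite /qint !big_ord_recl big_ord0 addr0 expr0.
apply: (scalerI q2); rewrite !scalerDl !scale1r.
move: m1 m2; set X := q *: (d * a); set Y := q *: (a * d) => m1 m2.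
apply: (addrI (X + Y)); rewrite (addrACA X Y (b * c)) (addrACA X Y (c * b)).
by rewrite !(addrC X) m1 -m2 addrC.
Qed.

Lemma M0D_Mq_rel :
  Mq_rel q (M0D_t q (1, 0)%N (1, 0)%N) (M0D_t q (1, 0)%N (0, 1)%N)
           (M0D_t q (0, 1)%N (1, 0)%N) (M0D_t q (0, 1)%N (0, 1)%N).
Proof.
have qb0 n : qbinom (q ^+ 2) n 0 = 1.
  by rewrite /qbinom subn0 {2}/qfact big_ord0 mul1r divff ?qfact_neq0.
have qbn n : qbinom (q ^+ 2) n n = 1.
  by rewrite /qbinom subnn {3}/qfact big_ord0 mulr1 divff ?qfact_neq0.
have n12 : nu q (1, 0)%N (0, 1)%N = 1 by rewrite /nu /mu /= qb0 qbn !mulr1.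
have n21 : nu q (0, 1)%N (1, 0)%N = q by rewrite /nu /mu /= qb0 qbn !mul1r.
have [ba dc m1] := quadratic_rel (M0D_comeas q) (mu_neq0 q_neq0 _ _)
  (mu_neq0 q_neq0 _ _) (expr0 _) (expr1 _).
have [ca db m2] := quadratic_rel (M0D_cocomeas q) (nu_neq0 q_neq0 q_generic _ _)
  (nu_neq0 q_neq0 q_generic _ _) n12 n21.
exact: Mq_rel_quadratic ba ca dc db m1 m2.
Qed.

End QuantumMatrices.

Section Identification.
Context (K : fieldType) (q : K) (q_neq0 : q != 0) (q_generic : generic q).
Local Notation idx := (nat * nat)%type.

Lemma coact10 (B : algebra K) (a b c d : B) I : coact q a b c d I (1, 0)%N =
  if I == (1, 0)%N then a else if I == (0, 1)%N then c else 0.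
Proof.
case: I => [[|[|i]] [|[|j]]]; rewrite /coact /step /unit0 /=;
  by rewrite ?expr0 ?scale1r ?(mulr0, mulr1, scaler0, addr0, add0r).
Qed.

Lemma coact01 (B : algebra K) (a b c d : B) I : coact q a b c d I (0, 1)%N =
  if I == (1, 0)%N then b else if I == (0, 1)%N then d else 0.
Proof.
case: I => [[|[|i]] [|[|j]]]; rewrite /coact /step /unit0 /=;
  by rewrite ?expr0 ?scale1r ?(mulr0, mulr1, scaler0, addr0, add0r).
Qed.

Definition ix (i : 'I_2) : idx := if i == 0 then (1, 0)%N else (0, 1)%N.

Lemma ord2P (i : 'I_2) : i = 0 \/ i = 1.
Proof. by case: i => [[|[|//]] ?]; [left|right]; apply: val_inj. Qed.

Lemma ix_eq i j : (ix i == ix j) = (i == j).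
Proof. by case: i j => [[|[|//]] ?] [[|[|//]] ?]. Qed.

Lemma Mq2_M0D_iso : exists (phi : Mq2 q -> M0D q) (psi : M0D q -> Mq2 q),
  [/\ alg_morphism phi, alg_morphism psi, cancel phi psi, cancel psi phi &
      forall i j, phi (Mq2_u q i j) = M0D_t q (ix i) (ix j)].
Proof.
have Mrel := M0D_Mq_rel q_neq0 q_generic; have Urel := Mq2_Mq_rel q_neq0.
have [phi [hphi [phia phib phic phid]]] := Mq2_lift q_neq0 Mrel.
have Tc := coact_comeas Urel.
have [psi [hpsi psit]] := M0D_lift Tc (coact_cocomeas q_neq0 q_generic Urel).
have phiu i j : phi (Mq2_u q i j) = M0D_t q (ix i) (ix j).
  by case: (ord2P i) => ->; case: (ord2P j) => ->.
have phiT I J : phi (psi (M0D_t q I J)) = M0D_t q I J.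
  rewrite psit.
  (* Both families comeasure, so the columns of [x] and [y] suffice. There the four degree-one
     entries match, and all others vanish: on one side by the definition of [coact], on the other by
     [M0D_wt]. *)
  apply: (comeas_eq (mu_neq0 q_neq0) (comeas_morph hphi Tc) (M0D_comeas q)) => {}I E.
  by rewrite !inE => /orP[]/eqP->; rewrite (coact10, coact01);
    (case: eqP => [->//|n1]; case: eqP => [->//|n2]);
    rewrite (morph0 hphi) M0D_wt //; case: I n1 n2 => [[|[|i]] [|[|j]]].
exists phi, psi; split=> //.
  apply: (Mq2_generates (morph_comp hphi hpsi) (morph_id _)) => -[i j] /=.
  rewrite phiu psit.
  case: (ord2P i) => ->; case: (ord2P j) => ->; by rewrite ?coact10 ?coact01.
by apply: (M0D_generates (morph_comp hpsi hphi) (morph_id _)) => -[I J] /=.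
Qed.

Lemma Mq2_identification :
  exists (D0 : M0 q -> tens (M0 q) (M0 q)) (e0 : M0 q -> K)
         (D1 : M0D q -> tens (M0D q) (M0D q)) (e1 : M0D q -> K)
         (D2 : Mq2 q -> tens (Mq2 q) (Mq2 q)) (e2 : Mq2 q -> K)
         (phi : Mq2 q -> M0D q),
    [/\ M0_bialgebra D0 e0,
        M0D_bialgebra D0 e0 D1 e1,
        Mq2_bialgebra D2 e2,
        bialg_morphism D2 e2 D1 e1 phi /\ bijective phi &
        forall i j, phi (Mq2_u q i j) = M0D_t q (ix i) (ix j)].
Proof.
have [D0 [e0 H0]] := M0_bialgebra_exists q_neq0.
have [D1 [e1 [H1 D1t e1t]]] := M0D_bialgebra_exists q_neq0 q_generic H0.
have [phi [psi [hphi hpsi phiK psiK phiu]]] := Mq2_M0D_iso.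
have hD1 : alg_morphism D1 by case: H1 => -[].
have he1 : alg_morphism (e1 : M0D q -> base_alg K) by case: H1 => -[].
have hpp := tens_map_morphism hpsi hpsi.
(* The structure on [Mq2 q] is transported along the isomorphism, so its relations need not be
   checked against the matrix coproduct. *)
pose D2 x := tens_map psi psi (D1 (phi x)).
pose e2 x := e1 (phi x).
have hD2 : alg_morphism D2 := morph_comp (morph_comp hphi hD1) hpp.
have he2 : alg_morphism (e2 : Mq2 q -> base_alg K) := morph_comp hphi he1.
have psit i j : psi (M0D_t q (ix i) (ix j)) = Mq2_u q i j by rewrite -phiu phiK.
have D2u i j : D2 (Mq2_u q i j) = \sum_(k < 2) Mq2_u q i k \ox Mq2_u q k j.
  have wi : wt (ix i) = 1%N by rewrite /ix; case: ifP.
  have -> : D2 (Mq2_u q i j) =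
      \sum_(L <- tri 1) psi (M0D_t q (ix i) L) \ox psi (M0D_t q L (ix j)).
    rewrite /D2 phiu D1t wi (morph_sum hpp); apply: eq_bigr => L _.
    exact: (tens_mapE hpsi hpsi).
  (* Besides the two indices of degree one, the range contains [(0, 0)], whose term vanishes by
     homogeneity. *)
  have -> : tri 1 = [:: (0, 0)%N; ix (lift ord0 ord0); ix 0] by [].
  rewrite big_cons M0D_wt ?wi // (morph0 hpsi) tensor0l add0r.
  rewrite [LHS]big_cons [X in _ + X = _]big_seq1 [RHS]big_ord_recl.
  by rewrite [X in _ = _ + X]big_ord1 [LHS]addrC !psit.
have e2u i j : e2 (Mq2_u q i j) = (i == j)%:R by rewrite /e2 phiu e1t ix_eq.
exists D0, e0, D1, e1, D2, e2, phi; split=> //.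
  split=> //; apply: (matrix_bialgebra (r := fun=> index_enum 'I_2)
    (Mq2_generates (q := q)) _ _ _ hD2 he2 D2u e2u) => [i|i k|i k _ l _].
  - exact: index_enum_uniq.
  - by rewrite mem_index_enum.
  - exact: mem_index_enum.
split; last by exists psi.
split=> // x; rewrite /D2 tens_map_comp // tens_map_id //.
Qed.

End Identification.

Theorem proposition3p2 (R : realType) (q : R[i])
    (q_neq0 : q != 0) (q_generic : generic q) :
  exists (D0 : M0 q -> tens (M0 q) (M0 q)) (e0 : M0 q -> R[i])
         (D1 : M0D q -> tens (M0D q) (M0D q)) (e1 : M0D q -> R[i])
         (D2 : Mq2 q -> tens (Mq2 q) (Mq2 q)) (e2 : Mq2 q -> R[i])
         (phi : Mq2 q -> M0D q),
    [/\ M0_bialgebra D0 e0,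
        M0D_bialgebra D0 e0 D1 e1,
        Mq2_bialgebra D2 e2,
        bialg_morphism D2 e2 D1 e1 phi /\ bijective phi &
        [/\ phi (Mq2_u q 0 0) = M0D_t q (1, 0)%N (1, 0)%N,
            phi (Mq2_u q 0 1) = M0D_t q (1, 0)%N (0, 1)%N,
            phi (Mq2_u q 1 0) = M0D_t q (0, 1)%N (1, 0)%N &
            phi (Mq2_u q 1 1) = M0D_t q (0, 1)%N (0, 1)%N]].
Proof.
have [D0 [e0 [D1 [e1 [D2 [e2 [phi [H0 H1 H2 H3 phiu]]]]]]]] :=
  Mq2_identification q_neq0 q_generic.
exists D0, e0, D1, e1, D2, e2, phi.
split; [exact: H0|exact: H1|exact: H2|exact: H3|].
by split; rewrite phiu.
Qed.
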